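(* Let $\Omega$ be an open bounded subset of $\mathbb{R}^d$ and let $\nu:\mathbb{R}^d\setminus\{0\}\to[0,\infty)$ be a measurable function. If the couple $(\nu,\Omega)$ belongs to one of the classes $\mathscr{A}_i$, $i=1,2,3$, then the embedding $H_\nu(\Omega)\hookrightarrow L^2(\Omega)$ is compact. In particular, the embedding $V_\nu(\Omega|\mathbb{R}^d)\hookrightarrow L^2(\Omega)$, $u\mapsto u|_\Omega$, is compact.
   Context: $H_\nu(\Omega)=\{u\in L^2(\Omega):\mathcal{E}_\Omega(u,u)<\infty\}$ with $\mathcal{E}_\Omega(u,u)=\iint_{\Omega\times\Omega}(u(x)-u(y))^2\nu(x-y)\,dx\,dy$ and $\|u\|^2_{H_\nu(\Omega)}=\|u\|^2_{L^2(\Omega)}+\mathcal{E}_\Omega(u,u)$ (similarly $H_\nu(\mathbb{R}^d)$). $V_\nu(\Omega|\mathbb{R}^d)$ is the space of measurable $u:\mathbb{R}^d\to\mathbb{R}$ with $u|_\Omega\in L^2(\Omega)$ and $|u|^2=\int_\Omega\int_{\mathbb{R}^d}(u(x)-u(y))^2\nu(x-y)\,dy\,dx<\infty$, with $\|u\|^2_{V_\nu(\Omega|\mathbb{R}^d)}=\|u\|^2_{L^2(\Omega)}+|u|^2$. Classes: let $\Omega$ be open and bounded and $\nu:\mathbb{R}^d\setminus\{0\}\to[0,\infty)$ measurable with $\nu(h)=\nu(-h)$, $\int_{\mathbb{R}^d}(1\wedge|h|^2)\nu(h)\,dh<\infty$ and $\int_{\mathbb{R}^d}\nu(h)\,dh=\infty$.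 Then $(\nu,\Omega)$ is in the class $\mathscr{A}_1$ if there is an extension operator $E:H_\nu(\Omega)\to H_\nu(\mathbb{R}^d)$, i.e. there is $C=C(\nu,\Omega,d)>0$ such that for every $u\in H_\nu(\Omega)$, $\|Eu\|_{H_\nu(\mathbb{R}^d)}\le C\|u\|_{H_\nu(\Omega)}$ and $Eu|_\Omega=u$; $\mathscr{A}_2$ if $\partial\Omega$ is Lipschitz-continuous, $\nu$ is radial and $q(\delta)\to\infty$ as $\delta\to0$, where $q(\delta)=\delta^{-2}\int_{B_\delta(0)}|h|^2\nu(h)\,dh$; $\mathscr{A}_3$ if $\widetilde q(\delta)\to\infty$ as $\delta\to0$, where $\widetilde q(\delta)=\inf_{a\in\partial\Omega}\int_{\Omega_\delta}\nu(h-a)\,dh$ and $\Omega_\delta=\{x\in\Omega:\operatorname{dist}(x,\partial\Omega)>\delta\}$. *)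

(* Defs.v *)
From HB Require Import structures.
From mathcomp Require Import all_boot all_order all_algebra.
From mathcomp Require Import all_classical all_reals all_analysis.

Set Implicit Arguments.
Unset Strict Implicit.
Unset Printing Implicit Defensive.

Import Order.TTheory GRing.Theory Num.Theory.
Import numFieldNormedType.Exports.

Local Open Scope classical_set_scope.
Local Open Scope ring_scope.

(* The sigma-algebra of R^n is generated by the coordinate functions, as for
   the library's n.-tuple R; measurable_rVE: it is the Borel sigma-algebra. *)
Section rV_measurable.
Context {R : realType} {n : nat}.

Definition rV_coord (i : 'I_n) (x : 'rV[R]_n) : R := x ord0 i.

Let rV_set0 : g_sigma_preimage rV_coord set0.
Proof. exact: sigma_algebra0. Qed.

Let rV_setC A : g_sigma_preimage rV_coord A ->
  g_sigma_preimage rV_coord (~` A).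
Proof. exact: sigma_algebraC. Qed.

Let rV_bigcup (F : _^nat) : (forall i, g_sigma_preimage rV_coord (F i)) ->
  g_sigma_preimage rV_coord (\bigcup_i (F i)).
Proof. exact: sigma_algebra_bigcup. Qed.

HB.instance Definition _ := @isMeasurable.Build default_measure_display
  'rV[R]_n (g_sigma_preimage rV_coord) rV_set0 rV_setC rV_bigcup.

Lemma measurable_rV_coord (i : 'I_n) :
  measurable_fun [set: 'rV[R]_n] (rV_coord i).
Proof.
move=> _ Y mY; rewrite setTI; apply: sub_sigma_algebra => /=.
rewrite -bigcup_seq/=; exists i => /=; first by rewrite mem_index_enum.
by exists Y => //; rewrite setTI.
Qed.

Lemma measurable_fun_rVP d (T : measurableType d) (f : T -> 'rV[R]_n) :
  (forall i, measurable_fun [set: T] (rV_coord i \o f)) ->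
  measurable_fun [set: T] f.
Proof.
move=> mf.
have sub : g_sigma_preimage rV_coord `<=` image_set_system setT f measurable.
  apply: smallest_sub.
    exact/sigma_algebra_image/sigma_algebra_measurable.
  rewrite -bigcup_seq => A [i _ [B mB <-]]; rewrite /image_set_system/= !setTI.
  by have := mf i measurableT B mB; rewrite setTI.
by move=> _ A mA; exact: sub.
Qed.

End rV_measurable.

Lemma measurable_rVE (R : realType) n :
  (measurable : set (set 'rV[R]_n)) = <<s (@open 'rV[R]_n) >>.
Proof.
rewrite eqEsubset; split.
  apply: smallest_sub; first exact: smallest_sigma_algebra.
  rewrite -bigcup_seq => _ [i _ [B + <-]]; rewrite setTI.
  have : measurable_fun [set: g_sigma_algebraType (@open 'rV[R]_n)]
      (rV_coord i : g_sigma_algebraType (@open 'rV[R]_n) -> R).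
    apply: (measurability _ (measurable_realfun.RGenOpens.measurableE R)) => //.
    move=> _ [_ [a [b ->] <-]]; rewrite setTI; apply: sub_sigma_algebra.
    apply: open_comp; last exact: interval_open.
    by move=> x _; exact: coord_continuous.
  by move=> mi mB; have := mi measurableT B mB; rewrite setTI.
apply: smallest_sub; first exact: sigma_algebra_measurable.
move=> U oU.
pose box (p : 'rV[rat]_n * 'rV[rat]_n) := [set x : 'rV[R]_n |
  forall i, x ord0 i \in `]ratr (p.1 ord0 i), ratr (p.2 ord0 i)[].
rewrite (_ : U = \bigcup_p (if `[< box p `<=` U >] then box p else set0)).
  apply: countable_bigcupT_measurable => // p; case: ifPn => // _.
  rewrite (_ : box p = \bigcap_(i in [set: 'I_n])
      (rV_coord i @^-1` `]ratr (p.1 ord0 i), ratr (p.2 ord0 i)[)).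
    apply: fin_bigcap_measurable => // i _.
    by rewrite -[X in measurable X]setTI; exact: measurable_rV_coord.
  by apply/seteqP; split => x /= h i; [move=> _|]; exact: h.
apply/seteqP; split => [x Ux|x [p _]]; last by case: ifPn => // /asboolP; exact.
have /nbhs_ballP[e /= e0 eU] := open_nbhs_nbhs (conj oU Ux).
have /choice[a ha] i : exists q : rat, ratr q \in `]x ord0 i - e, x ord0 i[.
  by apply: rat_in_itvoo; rewrite ltrBlDr ltrDl.
have /choice[b hb] i : exists q : rat, ratr q \in `]x ord0 i, x ord0 i + e[.
  by apply: rat_in_itvoo; rewrite ltrDl.
exists (\row_i a i, \row_i b i) => //.
rewrite ifT; last first.
  apply/asboolP => y yab; apply: eU; split => // i j; rewrite ord1.
  have := yab j; rewrite /= !mxE in_itv/= => /andP[ay yb].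
  have := ha j; have := hb j; rewrite !in_itv/= => /andP[_ be] /andP[ae _].
  rewrite /ball/= ltr_distlC (lt_trans ae ay)/=; exact: lt_trans yb be.
move=> i /=; rewrite !mxE in_itv/=.
by have := ha i; have := hb i; rewrite !in_itv/= => /andP[-> _] /andP[_ ->].
Qed.

Section rV_cons.
Context {R : realType} {n : nat}.

Definition rV_cons (p : (R * 'rV[R]_n)%type) : 'rV[R]_n.+1 :=
  row_mx (p.1%:M : 'M[R]_1) p.2.

Lemma rV_cons0 p : rV_cons p ord0 ord0 = p.1.
Proof.
transitivity ((row_mx (p.1%:M : 'M[R]_1) p.2) ord0 (lshift n ord0)).
  by congr (rV_cons p _ _); exact/val_inj.
by rewrite row_mxEl mxE eqxx mulr1n.
Qed.

Lemma rV_consS p i : rV_cons p ord0 (lift ord0 i) = p.2 ord0 i.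
Proof.
transitivity ((row_mx (p.1%:M : 'M[R]_1) p.2) ord0 (rshift 1 i)).
  by congr (rV_cons p _ _); exact/val_inj.
by rewrite row_mxEr.
Qed.

Lemma measurable_rV_cons : measurable_fun [set: (R * 'rV[R]_n)%type] rV_cons.
Proof.
apply: measurable_fun_rVP => i.
have [->|[j ->]] : i = ord0 \/ exists j, i = lift ord0 j.
  by case: (unliftP ord0 i) => [j ->|->]; [right; exists j|left].
- rewrite (_ : _ \o _ = fst) //.
  by apply/funext => p /=; exact: rV_cons0.
- rewrite (_ : _ \o _ = rV_coord j \o snd).
    by apply: measurableT_comp => //; exact: measurable_rV_coord.
  by apply/funext => p /=; exact: rV_consS.
Qed.

End rV_cons.

(* Lebesgue measure on R^(n+1), transported from the product of the Lebesgue
   measures on R and on R^n. *)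
Section lebesgue_rV_step.
Context {R : realType} {n : nat}.
Variable mu : {sigma_finite_measure set 'rV[R]_n -> \bar R}.

Definition lebesgue_rV_step :=
  pushforward (@lebesgue_measure R \x mu)%E (@rV_cons R n).

Let step0 : lebesgue_rV_step set0 = 0%E.
Proof. by rewrite /lebesgue_rV_step /pushforward preimage_set0 measure0. Qed.

Let step_ge0 A : (0 <= lebesgue_rV_step A)%E.
Proof. by apply: measure_ge0; exact: measurable_rV_cons. Qed.

Let step_sigma_additive : semi_sigma_additive lebesgue_rV_step.
Proof.
by apply: measure_semi_sigma_additive; exact: measurable_rV_cons.
Qed.

HB.instance Definition _ := isMeasure.Build _ _ _ lebesgue_rV_step
  step0 step_ge0 step_sigma_additive.

Lemma lebesgue_rV_stepE (A : set R) (B : set 'rV[R]_n) :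
  measurable A -> measurable B ->
  lebesgue_rV_step [set x : 'rV[R]_n.+1 | A (x ord0 ord0) /\ B (\row_i x ord0 (lift ord0 i))]
  = (lebesgue_measure A * mu B)%E.
Proof.
move=> mA mB; rewrite /lebesgue_rV_step /pushforward -product_measure1E//.
congr (_ _); apply/seteqP; split => -[x y] /=;
  rewrite rV_cons0 (_ : (\row__ _) = y)//; apply/rowP => i;
  by rewrite mxE rV_consS.
Qed.

Let step_sigma_finite : sigma_finite setT lebesgue_rV_step.
Proof.
have /sigma_finiteP[F [TF ndF Foo]] := sigma_finiteT (@lebesgue_measure R).
have /sigma_finiteP[G [TG ndG Goo]] := sigma_finiteT mu.
exists (fun k => [set x : 'rV[R]_n.+1 | F k (x ord0 ord0) /\
    G k (\row_i x ord0 (lift ord0 i))]).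
  apply/seteqP; split => // x _.
  have [k _ Fk] : (\bigcup_i F i) (x ord0 ord0) by rewrite -TF.
  have [l _ Gl] : (\bigcup_i G i) (\row_i x ord0 (lift ord0 i)) by rewrite -TG.
  exists (maxn k l) => //=; split.
    by move: Fk; apply/subsetPset/ndF; rewrite leq_maxl.
  by move: Gl; apply/subsetPset/ndG; rewrite leq_maxr.
move=> k; have [mF Fk] := Foo k; have [mG Gk] := Goo k; split; last first.
  by rewrite lebesgue_rV_stepE// lte_mul_pinfty// ge0_fin_numE.
rewrite (_ : mkset _ = (rV_coord ord0 @^-1` F k) `&`
  ((fun x : 'rV[R]_n.+1 => \row_i x ord0 (lift ord0 i)) @^-1` G k))//.
apply: measurableI.
  by rewrite -[X in measurable X]setTI; exact: measurable_rV_coord.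
rewrite -[X in measurable X]setTI; apply: measurable_fun_rVP mG => // i.
rewrite (_ : _ \o _ = rV_coord (lift ord0 i)); first exact: measurable_rV_coord.
by apply/funext => x; rewrite /rV_coord/= mxE.
Qed.

HB.instance Definition _ := Measure_isSigmaFinite.Build _ _ _ lebesgue_rV_step
  step_sigma_finite.

End lebesgue_rV_step.

Section lebesgue_rV0.
Context {R : realType}.

Definition lebesgue_rV0 : set 'rV[R]_0 -> \bar R := \d_(0 : 'rV[R]_0).

HB.instance Definition _ := Measure.on lebesgue_rV0.

Let rV0_sigma_finite : sigma_finite setT lebesgue_rV0.
Proof.
exists (fun=> setT); first by apply/seteqP; split => // x _; exists 0%N.
by move=> i; split=> //; rewrite /lebesgue_rV0 diracT ltry.
Qed.

HB.instance Definition _ := Measure_isSigmaFinite.Build _ _ _ lebesgue_rV0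
  rV0_sigma_finite.

End lebesgue_rV0.

Fixpoint lebesgue_rV (R : realType) (n : nat) :
    {sigma_finite_measure set 'rV[R]_n -> \bar R} :=
  if n is m.+1 then lebesgue_rV_step (lebesgue_rV R m) else @lebesgue_rV0 R.

Lemma lebesgue_rV_prod (R : realType) n (A : 'I_n -> set R) :
  (forall i, measurable (A i)) ->
  lebesgue_rV R n [set x : 'rV[R]_n | forall i, A i (x ord0 i)] =
  (\prod_i lebesgue_measure (A i))%E.
Proof.
elim: n A => [|n IH] A mA.
  rewrite big_ord0 (_ : [set x : 'rV[R]_0 | forall i, A i (x ord0 i)] = setT).
    by rewrite /= /lebesgue_rV0 diracT.
  by apply/seteqP; split => // x _ i; case: i.
rewrite big_ord_recl -(IH (fun i => A (lift ord0 i)))// -lebesgue_rV_stepE//.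
  congr (lebesgue_rV_step _ _); apply/seteqP; split => x /=.
    by move=> Ax; split => // i; rewrite mxE.
  move=> [A0 AS] i; case: (unliftP ord0 i) => [j ->|->//].
  by have := AS j; rewrite mxE.
rewrite (_ : mkset _ = \bigcap_(i in [set: 'I_n])
    (rV_coord i @^-1` A (lift ord0 i))).
  apply: fin_bigcap_measurable => // i _.
  by rewrite -[X in measurable X]setTI; exact: measurable_rV_coord.
by apply/seteqP; split => x /= h i; [move=> _|]; exact: h.
Qed.

Section euclidean.
Context {R : realType}.

(* The canonical norm of 'rV[R]_n is the sup norm; it induces the same open
   sets and the same bounded sets. *)
Definition enorm n (x : 'rV[R]_n) : R := Num.sqrt (\sum_i x ord0 i ^+ 2).

Definition edist_set n (x : 'rV[R]_n) (A : set 'rV[R]_n) : \bar R :=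
  ereal_inf [set (enorm (x - a))%:E | a in A].

Definition boundary n (A : set 'rV[R]_n) : set 'rV[R]_n :=
  closure A `\` interior A.

(* Near each boundary point, after a linear isometry Q, the set is the strict
   epigraph, in the last coordinate, of a Lipschitz function of the others. *)
Definition lipschitz_boundary n (Omega : set 'rV[R]_n.+1) : Prop :=
  forall a, boundary Omega a ->
  exists (r L : R) (Q : 'M[R]_n.+1) (g : 'rV[R]_n -> R),
    [/\ 0 < r, Q *m Q^T = 1%:M,
        forall y z, `|g y - g z| <= L * enorm (y - z) &
        forall x : 'rV[R]_n.+1, enorm (x - a) < r ->
          (Omega x <-> g (col' ord_max (x *m Q)) < (x *m Q) ord0 ord_max)].

End euclidean.

Section compact_operator.
Context {R : realType} {V : Type} {W : zmodType}.

(* Compactness of a map j from the normed space (X, NX) into the normed space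
   (Y, NY): it sends every bounded sequence to a sequence that has a
   convergent subsequence. *)
Definition compact_operator (X : set V) (NX : V -> \bar R)
    (Y : set W) (NY : W -> \bar R) (j : V -> W) : Prop :=
  (forall u, X u -> Y (j u)) /\
  forall u : nat -> V, (forall k, X (u k)) ->
    (exists M : R, forall k, (NX (u k) <= M%:E)%E) ->
    exists phi : nat -> nat, {homo phi : k l / (k < l)%N} /\
    exists2 v : W, Y v & NY (j (u (phi k)) - v) @[k --> \oo] --> 0%E.

End compact_operator.

Section spaces.
Context {R : realType} {n : nat}.
Local Notation leb := (lebesgue_rV R n).
Implicit Types (nu u : 'rV[R]_n -> R) (D : set 'rV[R]_n).

(* An element of L^2(D) or H_nu(D) is represented by a function on R^n of which
   only the values on D matter. *)
Definition L2 D : set ('rV[R]_n -> R) :=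
  [set u | (u \_ D) \in Lfun leb 2%:E].

Definition L2norm D u : \bar R := 'N[leb]_2%:E[EFin \o (u \_ D)].

(* nu is a kernel on R^n \ {0}: its value at 0 is never used, since
   u z.1 - u z.2 vanishes on the diagonal. *)
Definition energy nu D u : \bar R :=
  \int[(leb \x leb)%E]_(z in D `*` D)
    ((u z.1 - u z.2) ^+ 2 * nu (z.1 - z.2))%:E.

Definition Hnu nu D : set ('rV[R]_n -> R) :=
  [set u | L2 D u /\ (energy nu D u < +oo)%E].

Definition Hnorm nu D u : \bar R :=
  ((L2norm D u ^+ 2 + energy nu D u) `^ 2^-1)%E.

Definition Venergy nu D u : \bar R :=
  \int[leb]_(x in D) \int[leb]_y ((u x - u y) ^+ 2 * nu (x - y))%:E.

Definition Vnu nu D : set ('rV[R]_n -> R) :=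
  [set u | [/\ measurable_fun setT u, L2 D u & (Venergy nu D u < +oo)%E]].

Definition Vnorm nu D u : \bar R :=
  ((L2norm D u ^+ 2 + Venergy nu D u) `^ 2^-1)%E.

End spaces.

Section classes.
Context {R : realType} {n : nat}.
Local Notation leb := (lebesgue_rV R n.+1).
Implicit Types (nu : 'rV[R]_n.+1 -> R) (Omega : set 'rV[R]_n.+1).

Definition admissible nu Omega : Prop :=
  [/\ open Omega, bounded_set Omega,
      measurable_fun [set~ (0%R : 'rV[R]_n.+1)] nu &
      forall h : 'rV[R]_n.+1, h != 0 -> 0 <= nu h] /\
  [/\ forall h : 'rV[R]_n.+1, h != 0 -> nu h = nu (- h),
      (\int[leb]_(h in [set~ (0%R : 'rV[R]_n.+1)])
         (Num.min 1 (enorm h ^+ 2) * nu h)%:E < +oo)%E &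
      (\int[leb]_(h in [set~ (0%R : 'rV[R]_n.+1)]) (nu h)%:E = +oo)%E].

(* The third clause says that the extension E is well defined on almost
   everywhere classes. *)
Definition class_A1 nu Omega : Prop :=
  admissible nu Omega /\
  exists (E : ('rV[R]_n.+1 -> R) -> ('rV[R]_n.+1 -> R)) (C : R),
    [/\ 0 < C,
        forall u, Hnu nu Omega u ->
          [/\ Hnu nu setT (E u),
              (Hnorm nu setT (E u) <= C%:E * Hnorm nu Omega u)%E &
              {ae leb, forall x, Omega x -> E u x = u x}] &
        forall u v, Hnu nu Omega u -> Hnu nu Omega v ->
          {ae leb, forall x, Omega x -> u x = v x} ->
          {ae leb, forall x, E u x = E v x}].

Definition q nu (delta : R) : \bar R :=
  ((delta ^- 2)%:E *
   \int[leb]_(h in [set h : 'rV[R]_n.+1 | (enorm h < delta)%R])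
     (enorm h ^+ 2 * nu h)%:E)%E.

Definition class_A2 nu Omega : Prop :=
  [/\ admissible nu Omega, lipschitz_boundary Omega,
      forall h k : 'rV[R]_n.+1, h != 0 -> k != 0 ->
        enorm h = enorm k -> nu h = nu k &
      q nu delta @[delta --> 0^'+] --> +oo%E].

Definition inner_set Omega (delta : R) : set 'rV[R]_n.+1 :=
  [set x | Omega x /\ (delta%:E < edist_set x (boundary Omega))%E].

Definition qtilde nu Omega (delta : R) : \bar R :=
  ereal_inf [set (\int[leb]_(h in inner_set Omega delta) (nu (h - a)%R)%:E)%E
            | a in boundary Omega].

Definition class_A3 nu Omega : Prop :=
  admissible nu Omega /\
  qtilde nu Omega delta @[delta --> 0^'+] --> +oo%E.

End classes.

(* Main.v *)
Require Import Defs.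
From HB Require Import structures.
From mathcomp Require Import all_boot all_order all_algebra.
From mathcomp Require Import all_classical all_reals all_analysis.
From mathcomp Require Import measurable_realfun ring lra.

Set Implicit Arguments.
Unset Strict Implicit.
Unset Printing Implicit Defensive.

Import Order.TTheory GRing.Theory Num.Theory.
Import numFieldNormedType.Exports.

Local Open Scope classical_set_scope.
Local Open Scope ring_scope.

                                             

(** The embedding is compact because [nu] has infinite mass near 0, so that bounded energy controls
    oscillation. Let D be contained in E, with E of finite measure, and suppose that for every N
    there is a simple kernel 0 <= K(x,y) <= nu(y - x) whose integral over y in E is at least N for
    all x in D. Weight f(x)^2 <= (f(x) - f(y))^2 + 2 f(x) f(y) by K and integrate over D x E: N
    times the squared L^2(D) norm of f is at most the energy of f on E plus twice the integral of
    K(x,y) f(x) f(y) ([coercive_bound]).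

    Apply this to the differences f_i - f_j of a bounded sequence. Their energies stay bounded, so
    they are harmless after division by N. The cross term tends to 0 as soon as f_i - f_j tends
    weakly to 0, because the products f(x) f(y) then integrate to 0 in the limit over every
    measurable set of pairs and K is simple ([weak_weighted_cross_cvg]). Weak convergence comes for
    free along a free ultrafilter, where each bounded sequence of integrals of f_i over a set has a
    limit. So the sequence is L^2(D)-Cauchy along the ultrafilter ([ultra_l2_cauchy]), and a
    diagonal choice together with completeness gives a convergent subsequence ([l2_subsequence]).

    The kernels K exist when D is bounded, E is open and [nu] has infinite integral over E - a for
    each a in the closure of D: simple functions increase to [nu], and compactness of the closure
    makes one of them good enough for all points ([kernel_bound]). It remains to check this
    divergence. At a point of E it holds because the tail of [nu] is integrable while its total mass
    is infinite ([interior_infinite]). In class A3, with D = E = Omega, a boundary point has the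
    lower bounds [qtilde], which tend to infinity ([class_A3_infinite]). In class A2, again with D =
    E = Omega, E - a contains a truncated cone; for a radial [nu] rotated cones carry the same mass,
    and finitely many of them cover all directions ([cone_integral], [class_A2_infinite]). In class
    A1 the functions are extended and E is a ball around the closure of Omega, so only interior
    points occur ([H_embedding_extension]). Finally, the V-norm dominates the H-norm
    ([V_embedding]). *)

(** The image of an ultrafilter is an ultrafilter, here one containing a compact segment. *)
Lemma ultra_bounded_cvg {R : realType} (I : Type) (U : set_system I)
    (a : I -> R) (M : R) :
  UltraFilter U -> (forall i, `|a i| <= M) -> cvg (a @ U).
Proof.
move=> UU aM.
have UaU : UltraFilter (a @ U).
  split; first exact: fmap_proper_filter.
  move=> G FG aUG; rewrite eqEsubset; split=> // A GA.
  have [//|UnA] := in_ultra_setVsetC (a @^-1` A) UU.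
  have : G (A `&` ~` A) by apply: filterI => //; exact: aUG.
  by rewrite setICr => /filter_not_empty.
have := @segment_compact R (- M) M.
rewrite compact_ultra => /(_ _ UaU)[|l [_ al]]; last by apply/cvg_ex; exists l.
rewrite /nbhs /=; apply: filterE => i /=.
by rewrite in_itv/= -ler_norml.
Qed.

(** * Products f(x) g(y) on the product space, and weak convergence to 0 *)

Section cross.
Context d (T : measurableType d) (R : realType).
Variable mu : {sigma_finite_measure set T -> \bar R}.
Local Notation mu2 := (mu \x mu)%E.

Lemma integral_prod_ge0 (f g : T -> R) :
  measurable_fun setT f -> measurable_fun setT g ->
  (forall x, 0 <= f x) -> (forall x, 0 <= g x) ->
  (\int[mu2]_z (f z.1 * g z.2)%:E =
   (\int[mu]_x (f x)%:E) * (\int[mu]_x (g x)%:E))%E.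
Proof.
move=> mf mg f0 g0.
rewrite fubini_tonelli1//=; last 2 first.
- apply/measurable_EFinP; apply: measurable_funM.
    exact: measurableT_comp.
  exact: measurableT_comp.
- by move=> z; rewrite lee_fin mulr_ge0.
rewrite /fubini_F/=.
under eq_integral => x _.
  under eq_integral do rewrite EFinM.
  rewrite ge0_integralZl//; [|exact/measurable_EFinP
    |by move=> *; rewrite lee_fin|by rewrite lee_fin].
  over.
rewrite ge0_integralZr//; first exact/measurable_EFinP.
- by move=> x _; rewrite lee_fin.
- by apply: integral_ge0 => x _; rewrite lee_fin.
Qed.

Lemma integrable_cross (f g : T -> R) :
  mu.-integrable setT (EFin \o f) -> mu.-integrable setT (EFin \o g) ->
  mu2.-integrable setT (fun z => (f z.1 * g z.2)%:E).
Proof.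
move=> /integrableP[/measurable_EFinP mf fi] /integrableP[/measurable_EFinP mg gi].
apply/integrableP; split.
  apply/measurable_EFinP; apply: measurable_funM.
    exact: measurableT_comp.
  exact: measurableT_comp.
under eq_integral do rewrite abse_EFin normrM.
rewrite [ltLHS](@integral_prod_ge0 (fun x => `|f x|) (fun x => `|g x|))//;
  [|exact: measurableT_comp..].
by rewrite lte_mul_pinfty// ?ge0_fin_numE// integral_ge0.
Qed.

Lemma Rintegral_cross (f g : T -> R) (A B : set T) :
  measurable A -> measurable B ->
  mu.-integrable setT (EFin \o f) -> mu.-integrable setT (EFin \o g) ->
  \int[mu2]_(z in A `*` B) (f z.1 * g z.2) =
  (\int[mu]_(x in A) f x) * (\int[mu]_(x in B) g x).
Proof.
move=> mA mB fi gi.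
rewrite Rintegral_mkcond.
rewrite [X in _ = X * _]Rintegral_mkcond [X in _ = _ * X]Rintegral_mkcond.
have fAi : mu.-integrable setT (EFin \o f \_ A).
  rewrite -restrict_EFin; apply/(integrable_mkcond _ mA).
  exact: (integrableS measurableT).
have gBi : mu.-integrable setT (EFin \o g \_ B).
  rewrite -restrict_EFin; apply/(integrable_mkcond _ mB).
  exact: (integrableS measurableT).
rewrite (_ : _ \_ _ = fun z => (f \_ A) z.1 * (g \_ B) z.2); last first.
  apply/funext => -[x y] /=; rewrite !patchE in_setX/=.
  by case: (x \in A); case: (y \in B) => /=; rewrite ?mul0r ?mulr0.
have := fubini1 (integrable_cross fAi gBi).
rewrite /fubini_F/=.
have : (\int[mu]_x \int[mu]_y ((f \_ A) x * (g \_ B) y)%:E =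
    \int[mu]_x ((f \_ A) x)%:E * \int[mu]_x ((g \_ B) x)%:E)%E.
  under eq_integral => x _.
    under eq_integral do rewrite EFinM.
    rewrite integralZl//.
    over.
  have := integrable_fin_num measurableT gBi.
  case: (integral _ _ _) => // r _.
  by rewrite (@integralZr _ _ _ mu _ measurableT (EFin \o f \_ A)).
move=> -> /esym; rewrite /Rintegral => ->.
by rewrite fineM// integrable_fin_num.
Qed.

End cross.

Section weak.
Context d (T : measurableType d) (R : realType).
Variable mu : {sigma_finite_measure set T -> \bar R}.
Local Notation mu2 := (mu \x mu)%E.
Variable E : set T.
Hypotheses (mE : measurable E) (Efin : (mu E < +oo)%E).

Lemma integrable_sqr_support (f : T -> R) :
  measurable_fun setT f -> (forall x, ~ E x -> f x = 0) ->
  (\int[mu]_x (f x ^+ 2)%:E < +oo)%E -> mu.-integrable setT (EFin \o f).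
Proof.
move=> mf fE ffin.
have f2i : mu.-integrable setT (EFin \o (fun x => f x ^+ 2)).
  apply/integrableP; split.
    by apply/measurable_EFinP; exact: measurable_funX.
  by under eq_integral do rewrite /= ger0_norm ?sqr_ge0//.
have Ei : mu.-integrable setT (EFin \o (\1_E : T -> R)).
  apply/integrableP; split; first by apply/measurable_EFinP; exact: measurable_indic.
  under eq_integral do rewrite /= ger0_norm//.
  by rewrite integral_indic// setIT.
apply: (le_integrable measurableT _ _ (integrableD measurableT Ei f2i)).
  exact/measurable_EFinP.
move=> x _ /=; rewrite lee_fin (le_trans _ (ler_norm _))// indicE.
have [xE|xE] := boolP (x \in E); last first.
  by rewrite fE ?normr0 ?expr0n ?addr0//; move/mem_set; exact/negP.
rewrite -real_normK ?num_real//=.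
have := sqr_ge0 (`|f x| - 1); have := normr_ge0 (f x); nra.
Qed.

Let cross_integrable (f : T -> R) :
  measurable_fun setT f -> (forall x, ~ E x -> f x = 0) ->
  (\int[mu]_x (f x ^+ 2)%:E < +oo)%E ->
  mu2.-integrable setT (fun z => (f z.1 * f z.2)%:E).
Proof. by move=> mf fE f2; apply: integrable_cross; exact: integrable_sqr_support. Qed.

(** Uniform integrability of f(x) f(y) over an L^2-ball: since |a| <= c a^2 + 1/c, the integral over
    Z is at most c B^2 plus 1/c times the measure of Z inside E x E. The point is that [t] depends
    on [B] and [e] only. *)
Lemma cross_small (B e : R) : 0 < e -> exists2 t : R, 0 < t &
  forall (f : T -> R) (Z : set (T * T)), measurable Z ->
  measurable_fun setT f -> (forall x, ~ E x -> f x = 0) ->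
  (\int[mu]_x (f x ^+ 2)%:E <= B%:E)%E ->
  (mu2 (Z `&` (E `*` E)) <= t%:E)%E ->
  `|\int[mu2]_(z in Z) (f z.1 * f z.2)| <= e.
Proof.
move=> e0.
(* This [c] makes c B^2 at most e/2, and t = c e / 2 turns t/c into the other e/2. *)
pose c := e / (2 * (B ^+ 2 + 1)).
have B1 : 0 < B ^+ 2 + 1 by rewrite ltr_wpDl ?sqr_ge0.
have c0 : 0 < c by rewrite divr_gt0// mulr_gt0.
exists (c * e / 2); first by rewrite divr_gt0// mulr_gt0.
move=> f Z mZ mf fE fB Zt.
have mEE : measurable (E `*` E) by exact: measurableX.
have ffin : (\int[mu]_x (f x ^+ 2)%:E < +oo)%E by exact: le_lt_trans fB (ltry _).
have ci := cross_integrable mf fE ffin.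
have ciZ : mu2.-integrable Z (EFin \o (fun z => f z.1 * f z.2)).
  exact: (integrableS measurableT).
rewrite -lee_fin EFin_normr_Rintegral//.
have mcr : measurable_fun setT (fun z : T * T => f z.1 * f z.2).
  by apply/measurable_EFinP; case/integrableP: ci.
apply: (le_trans (le_abse_integral _ mZ _)).
  by apply/measurable_EFinP; exact: measurable_funTS.
                                          
apply: (@le_trans _ _ (\int[mu2]_(z in Z) ((c * (f z.1 ^+ 2 * f z.2 ^+ 2))%:E
    + (c^-1 * \1_(E `*` E) z)%:E))%E).
  apply: ge0_le_integral => //.
  - by apply/measurable_EFinP; apply: measurableT_comp => //; exact: measurable_funTS.
  - apply/measurable_EFinP; apply: measurable_funD.
      apply: measurable_funM => //; under eq_fun do rewrite -exprMn.
      by apply: measurable_funX; exact: measurable_funTS.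
    by apply: measurable_funM => //; exact: measurable_indic.
  move=> [x y] _ /=; rewrite lee_fin indicE.
  have [/=|] := boolP ((x, y) \in E `*` E).
    move=> _; rewrite mulr1 -exprMn -[(_ ^+ 2)]real_normK ?num_real//.
    set a := `|_|; have : a <= (c * a ^+ 2 + c^-1) => //.
    have cc : c * c^-1 = 1 by rewrite divff// gt_eqF.
    have ci0 : 0 < c^-1 by rewrite invr_gt0.
    have := sqr_ge0 (c * a - 1); have : 0 <= a by exact: normr_ge0.
    move=> a0 h.
    rewrite -(ler_pM2l c0) mulrDr cc.
    nra.
  move=> xyE; have -> : f x * f y = 0.
    move: xyE; rewrite in_setX/= negb_and => /orP[] xE.
      by rewrite fE ?mul0r//; move/mem_set; exact/negP.
    by rewrite (fE y) ?mulr0//; move/mem_set; exact/negP.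
  rewrite normr0 mulr0 addr0 mulr_ge0 ?(ltW c0)// mulr_ge0 // sqr_ge0 //.
have ci0 : 0 <= c^-1 by rewrite invr_ge0 ltW.
have mf2 : measurable_fun setT (fun z : T * T => c * (f z.1 ^+ 2 * f z.2 ^+ 2)).
  apply: measurable_funM => //; under eq_fun do rewrite -exprMn.
  exact: measurable_funX.
have sq4 (z : T * T) : 0 <= c * (f z.1 ^+ 2 * f z.2 ^+ 2).
  by rewrite mulr_ge0 ?(ltW c0)// mulr_ge0 ?sqr_ge0.
have mI : measurable_fun setT (fun z : T * T => c^-1 * (\1_(E `*` E) z : R)).
  by apply: measurable_funM => //; exact: measurable_indic.
rewrite ge0_integralD//=; first last.
- by apply/measurable_EFinP; exact: measurable_funTS.
- by move=> z _; rewrite lee_fin mulr_ge0.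
- by apply/measurable_EFinP; exact: measurable_funTS.
- by move=> z _; rewrite lee_fin sq4.
rewrite (splitr e) EFinD leeD//.
  apply: (@le_trans _ _ (\int[mu2]_z (c * (f z.1 ^+ 2 * f z.2 ^+ 2))%:E)%E).
    apply: ge0_subset_integral => //; first exact/measurable_EFinP.
    by move=> z _; rewrite lee_fin sq4.
  under eq_integral do rewrite EFinM.
  rewrite ge0_integralZl//=; last 3 first.
  - apply/measurable_EFinP; under eq_fun do rewrite -exprMn.
    exact: measurable_funX.
  - by move=> z _; rewrite lee_fin mulr_ge0 ?sqr_ge0.
  - by rewrite lee_fin ltW.
  rewrite (@integral_prod_ge0 _ _ _ mu (fun x => f x ^+ 2) (fun x => f x ^+ 2));
    [|exact: measurable_funX|exact: measurable_funX
     |by move=> x; exact: sqr_ge0|by move=> x; exact: sqr_ge0].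
  apply: (@le_trans _ _ (c%:E * (B%:E * B%:E))%E).
    apply: lee_pmul => //; first by rewrite lee_fin ltW.
      by rewrite mule_ge0// integral_ge0// => x _; rewrite lee_fin sqr_ge0.
    by apply: lee_pmul => //; apply: integral_ge0 => x _; rewrite lee_fin sqr_ge0.
  rewrite -!EFinM lee_fin /c -expr2.
  rewrite (_ : e / (2 * (B ^+ 2 + 1)) * B ^+ 2 = e / 2 * (B ^+ 2 / (B ^+ 2 + 1))); last first.
    by field; rewrite gt_eqF.
  rewrite ler_piMr//; first by rewrite divr_ge0// ltW.
  by rewrite ler_pdivrMr// mul1r lerDl.
under eq_integral do rewrite EFinM.
rewrite ge0_integralZl//=; last first.
  by apply/measurable_EFinP/measurable_funTS; exact: measurable_indic.
rewrite integral_indic// setIC.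
apply: (@le_trans _ _ (c^-1%:E * (c * e / 2)%:E)%E).
  by apply: lee_pmul.
rewrite -EFinM lee_fin (_ : c^-1 * (c * e / 2) = e / 2)//.
by field; exact: lt0r_neq0.
Qed.

Variables (I : Type) (F : set_system I) (FF : Filter F) (g : I -> T -> R) (B : R).
Hypotheses (mg : forall i, measurable_fun setT (g i))
  (gE : forall i x, ~ E x -> g i x = 0)
  (gB : forall i, (\int[mu]_x (g i x ^+ 2)%:E <= B%:E)%E)
  (gw : forall A, measurable A -> \int[mu]_(x in A) g i x @[i --> F] --> (0:R)).

Let gci i S : measurable S ->
  mu2.-integrable S (EFin \o (fun z => g i z.1 * g i z.2)).
Proof.
move=> mS; apply: (integrableS measurableT) => //.
apply: cross_integrable => //; first exact: gE.
exact: le_lt_trans (gB _) (ltry _).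
Qed.

(** On a rectangle the integral factors into two integrals that tend to 0. Rectangles form a
    pi-system generating the product sigma-algebra, and the sets for which the claim holds form a
    lambda-system. *)
Lemma weak_cross_cvg (S : set (T * T)) : measurable S ->
  \int[mu2]_(z in S) (g i z.1 * g i z.2) @[i --> F] --> (0:R).
Proof.
pose P := [set S | measurable S /\
  \int[mu2]_(z in S) (g i z.1 * g i z.2) @[i --> F] --> (0:R)].
suff : measurable `<=` P by move=> + mS => /(_ _ mS)[].
rewrite measurable_prod_measurableType.
set G := [set A1 `*` A2 | A1 in measurable & A2 in measurable].
have GI : setI_closed G.
  move=> X Y [X1 mX1 [X2 mX2 <-{X}]] [Y1 mY1 [Y2 mY2 <-{Y}]].
  exists (X1 `&` Y1); first exact: measurableI.
  by exists (X2 `&` Y2); [exact: measurableI|rewrite setXI].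
have GP : G `<=` P.
  move=> _ [A mA [A' mA' <-]]; split; first exact: measurableX.
  have gi i : mu.-integrable setT (EFin \o g i).
    apply: integrable_sqr_support => //; first exact: gE.
    exact: le_lt_trans (gB i) (ltry _).
  rewrite (_ : (fun i => _) = fun i =>
    (\int[mu]_(x in A) g i x) * (\int[mu]_(x in A') g i x)); last first.
    by apply/funext => i; exact: Rintegral_cross.
  by have := cvgM (gw mA) (gw mA'); rewrite mulr0; apply.
apply: lambda_system_subset => //; split => //.
- by apply: GP; exists setT => //; exists setT => //; rewrite setXTT.
- move=> X Y YX [mX cX] [mY cY]; split; first exact: measurableD.
  have -> : (fun i => \int[mu2]_(z in X `\` Y) (g i z.1 * g i z.2)) =
      (fun i => \int[mu2]_(z in X) (g i z.1 * g i z.2) -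
                \int[mu2]_(z in Y) (g i z.1 * g i z.2)).
    apply/funext => i; apply/esym/eqP; rewrite subr_eq; apply/eqP.
    rewrite addrC -Rintegral_setU ?setDUK//; [exact: measurableD|exact: gci|].
    by rewrite disj_set2E setDIK.
  by rewrite -(subr0 0); apply: cvgB.
(* Increasing unions: what is left outside [S_ n] has small measure within E x E, so [cross_small]
   bounds its contribution uniformly in the index, and only the fixed set [S_ n] needs the limit. *)
- move=> S_ ndS PS.
  have mS i : measurable (S_ i) by case: (PS i).
  have mUS : measurable (\bigcup_i S_ i) by exact: bigcupT_measurable.
  split => //; apply/cvgr0Pnorm_le => e e0.
  have e20 : 0 < e / 2 by rewrite divr_gt0.
  have [t t0 small] := cross_small B e20.
  have [n nt] : exists n, (mu2 ((\bigcup_i S_ i `\` S_ n) `&` (E `*` E)) <= t%:E)%E.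
    pose Z n := (\bigcup_i S_ i `\` S_ n) `&` (E `*` E).
    have mZ n : measurable (Z n).
      by apply: measurableI; [exact: measurableD|exact: measurableX].
    have : mu2 \o Z @ \oo --> mu2 (\bigcap_n Z n).
      apply: nonincreasing_cvg_mu => //.
      - apply: (@le_lt_trans _ _ (mu2 (E `*` E))).
          by apply: le_measure; rewrite ?inE//; [exact: measurableX|exact: subIsetr].
        by rewrite /= product_measure1E// lte_mul_pinfty// ge0_fin_numE.
      - exact: bigcapT_measurable.
      - move=> m n mn; apply/subsetPset; apply: setSI; apply: setDS.
        exact/subsetPset/ndS.
    rewrite (_ : \bigcap_n Z n = set0) ?measure0; last first.
      rewrite -subset0 => z Zz; have [[[i _ Si] _] _] := Zz 0%N Logic.I.
      by have [[_]] := Zz i Logic.I.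
    move=> /fine_cvgP[Zfin /cvgr0Pnorm_le/(_ _ t0)] Zt.
    have [n [Zn]] := @filter_ex _ _ _ _ (filterI Zfin Zt).
    move=> nt; exists n; rewrite -[leLHS](fineK Zn) lee_fin.
    exact: le_trans (ler_norm _) nt.
  have [_ /cvgr0Pnorm_le /(_ _ e20)] := PS n.
  apply: filterS => i hi.
  rewrite (_ : \int[mu2]_(z in \bigcup_i S_ i) _ =
    \int[mu2]_(z in S_ n) (g i z.1 * g i z.2) +
    \int[mu2]_(z in \bigcup_i S_ i `\` S_ n) (g i z.1 * g i z.2)).
    rewrite (le_trans (ler_normD _ _))// (splitr e) lerD//.
    apply: small => //; first exact: measurableD.
    exact: gE.
  rewrite -Rintegral_setU//.
  - by rewrite setDUK//; exact: bigcup_sup.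
  - exact: measurableD.
  - by rewrite setDUK; [exact: gci|exact: bigcup_sup].
  - by rewrite disj_set2E setDIK.
Qed.

(** A kernel of finite range is a finite combination of indicators of its level sets, which reduces
    the claim to the unweighted case on each level set. *)
Lemma weak_weighted_cross_cvg (K : T * T -> R) (S : set (T * T)) :
  measurable_fun setT K -> finite_set (range K) -> measurable S ->
  \int[mu2]_(z in S) (K z * (g i z.1 * g i z.2)) @[i --> F] --> (0:R).
Proof.
move=> mK fK mS.
pose s := finmap.enum_fset (fset_set (range K)).
have mA r : measurable (K @^-1` [set r]).
  by rewrite -[X in measurable X]setTI; exact: mK.
have KE z : K z = \sum_(r <- s) r * \1_(K @^-1` [set r]) z.
  rewrite -(@fsbig_finite _ _ _ _ (range K) (fun r => r * \1_(K @^-1` [set r]) z))//.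
  rewrite (fsbigD1 (K z))//= ?indicE ?mem_set// ?mulr1; last by exists z.
  rewrite fsbig1 ?addr0//.
  by move=> y [_ /= /nesym yKz]; rewrite indicE memNset ?mulr0.
have -> : (fun i => \int[mu2]_(z in S) (K z * (g i z.1 * g i z.2))) =
    fun i => \sum_(r <- s) r * \int[mu2]_(z in S `&` (K @^-1` [set r]))
      (g i z.1 * g i z.2).
  apply/funext => i.
  pose h r (z : T * T) := r * (\1_(K @^-1` [set r]) z * (g i z.1 * g i z.2)).
  have i1 r : mu2.-integrable S
      (EFin \o (fun z => \1_(K @^-1` [set r]) z * (g i z.1 * g i z.2))).
    have := @integrableMr _ _ _ mu2 S mS (\1_(K @^-1` [set r])) _ _ _ (gci i mS).
    apply.
      by apply: measurable_funTS; exact: measurable_indic.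
    by exists 1; split=> // t t1 z _ /=; rewrite (le_trans _ (ltW t1))// indicE;
      case: (_ \in _); rewrite ?normr1 ?normr0.
  transitivity (\sum_(r <- s) \int[mu2]_(z in S) h r z); last first.
    apply: eq_bigr => r _; rewrite RintegralZl//; congr (_ * _).
    rewrite Rintegral_mkcondr; apply: eq_Rintegral => z _.
    by rewrite patchE indicE; case: ifPn; rewrite ?mul1r ?mul0r.
  rewrite /Rintegral.
  rewrite (eq_integral (fun z => \sum_(r <- s) (h r z)%:E)%E); last first.
    by move=> z _; rewrite KE mulr_suml sumEFin; congr _%:E;
       apply: eq_bigr => r _; rewrite /h -mulrA.
  have i2 r : mu2.-integrable S (EFin \o h r) by exact: (integrableZl mS r (i1 r)).
  rewrite integral_sum//.
  rewrite (eq_bigr (fun r => (fine (\int[mu2]_(z in S) (h r z)%:E)%E)%:E)) ?sumEFin//.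
  by move=> r _; rewrite fineK//; exact: (integrable_fin_num mS (i2 r)).
have c0 r : r * \int[mu2]_(z in S `&` (K @^-1` [set r]))
    (g i z.1 * g i z.2) @[i --> F] --> (0:R).
  rewrite -(mulr0 r); apply: cvgMl_tmp.
  by apply: weak_cross_cvg; exact: measurableI.
elim: s {KE} => [|r s IH].
  by under eq_fun do rewrite big_nil; exact: cvg_cst.
under eq_fun do rewrite big_cons.
by have := cvgD (c0 r) IH; rewrite addr0; apply.
Qed.

End weak.

(** * The coercivity estimate *)

Section coercive.
Context d (T : measurableType d) (R : realType).
Variable mu : {sigma_finite_measure set T -> \bar R}.
Local Notation mu2 := (mu \x mu)%E.

Lemma tonelli_setX (A B : set T) (h : T * T -> \bar R) :
  measurable A -> measurable B -> measurable_fun setT h ->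
  (forall z, 0 <= h z)%E ->
  (\int[mu2]_(z in A `*` B) h z =
   \int[mu]_(x in A) \int[mu]_(y in B) h (x, y))%E.
Proof.
move=> mA mB mh h0.
have mAB : measurable (A `*` B) by exact: measurableX.
rewrite integral_mkcond fubini_tonelli1; last 2 first.
- by apply/(measurable_restrictT _ mAB); exact: measurable_funTS.
- by move=> z; exact: erestrict_ge0.
rewrite [RHS]integral_mkcond; apply: eq_integral => x _.
rewrite /fubini_F patchE; case: ifPn => xA.
  rewrite [RHS]integral_mkcond; apply: eq_integral => y _.
  by rewrite !patchE in_setX/= xA.
by apply: integral0_eq => y _; rewrite patchE in_setX/= (negbTE xA).
Qed.

Lemma measurable_integral_setX (B : set T) (h : T * T -> \bar R) :
  measurable B -> measurable_fun setT h -> (forall z, 0 <= h z)%E ->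
  measurable_fun setT (fun x => \int[mu]_(y in B) h (x, y))%E.
Proof.
move=> mB mh h0.
have mTB : measurable ([set: T] `*` B) by exact: measurableX.
rewrite (_ : (fun x => _) = fubini_F mu (h \_ ([set: T] `*` B))).
  apply: measurable_fun_fubini_tonelli_F; last by move=> z; exact: erestrict_ge0.
  by apply/(measurable_restrictT _ mTB); exact: measurable_funTS.
apply/funext => x; rewrite /fubini_F [LHS]integral_mkcond; apply: eq_integral => y _.
by rewrite !patchE in_setX in_setT.
Qed.

Variables (D E : set T).
Hypotheses (mD : measurable D) (mE : measurable E) (DE : D `<=` E)
  (Efin : (mu E < +oo)%E).
Variable k : T * T -> R.
Hypotheses (mk : measurable_fun setT k) (k0 : forall z, 0 <= k z).

Lemma integrable_weighted_cross (f : T -> R) (K : T * T -> R) (S : set (T * T)) :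
  measurable_fun setT f -> (forall x, ~ E x -> f x = 0) ->
  (\int[mu]_x (f x ^+ 2)%:E < +oo)%E ->
  measurable_fun setT K -> finite_set (range K) -> measurable S ->
  mu2.-integrable S (EFin \o (fun z => K z * (f z.1 * f z.2))).
Proof.
move=> mf fE f2 mK fK mS.
have fi := integrable_sqr_support mE Efin mf fE f2.
have ci : mu2.-integrable S (EFin \o (fun z => f z.1 * f z.2)).
  exact: (integrableS measurableT) (integrable_cross fi fi).
have := @integrableMr _ _ _ mu2 S mS K _ _ _ ci.
apply; first exact: measurable_funTS.
pose s := finmap.enum_fset (fset_set (range K)).
exists (\sum_(r <- s) `|r|); split; first by rewrite num_real.
move=> t st z _ /=; rewrite (le_trans _ (ltW st))//.
have Ks : K z \in s.
  rewrite in_fset_set// inE; by exists z.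
by rewrite (big_rem _ Ks)/= lerDl sumr_ge0.
Qed.

(** Integrate f(x)^2 <= (f(x) - f(y))^2 + 2 f(x) f(y) against K over D x E, and replace K by k in
    the square only. The cross term keeps the bounded kernel K, against which it is integrable;
    against the singular k it need not be. *)
Lemma coercive_bound (f : T -> R) (K : T * T -> R) (N A : R) :
  measurable_fun setT f -> (forall x, ~ E x -> f x = 0) ->
  (\int[mu]_x (f x ^+ 2)%:E < +oo)%E ->
  measurable_fun setT K -> finite_set (range K) ->
  (forall z, 0 <= K z <= k z) -> 0 <= N ->
  (forall x, D x -> N%:E <= \int[mu]_(y in E) (K (x, y))%:E)%E ->
  (\int[mu2]_(z in E `*` E) ((f z.1 - f z.2) ^+ 2 * k z)%:E <= A%:E)%E ->
  (N%:E * \int[mu]_(x in D) (f x ^+ 2)%:E <=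
   (A + 2 * \int[mu2]_(z in D `*` E) (K z * (f z.1 * f z.2)))%:E)%E.
Proof.
move=> mf fE f2 mK fK Kk N0 NK fA.
have mDE : measurable (D `*` E) by exact: measurableX.
have mEE : measurable (E `*` E) by exact: measurableX.
have mf1 : measurable_fun setT (fun z : T * T => f z.1) by exact: measurableT_comp.
have mf2 : measurable_fun setT (fun z : T * T => f z.2) by exact: measurableT_comp.
have K0 z : 0 <= K z by case/andP: (Kk z).
have mfk : measurable_fun setT (fun z : T * T => (f z.1 - f z.2) ^+ 2 * k z).
  by apply: measurable_funM => //; apply: measurable_funX; exact: measurable_funB.
have mfK : measurable_fun setT (fun z : T * T => f z.1 ^+ 2 * K z).
  by apply: measurable_funM => //; exact: measurable_funX.
have e0 z : 0 <= (f z.1 - f z.2) ^+ 2 * k z by rewrite mulr_ge0// sqr_ge0.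
have eDE : (\int[mu2]_(z in D `*` E) ((f z.1 - f z.2) ^+ 2 * k z)%:E <= A%:E)%E.
  apply: le_trans fA; apply: ge0_subset_integral => //.
  - by apply/measurable_EFinP; exact: measurable_funTS.
  - by move=> z _; rewrite lee_fin.
  - by move=> z [/= /DE].
have i1 : mu2.-integrable (D `*` E) (EFin \o (fun z => (f z.1 - f z.2) ^+ 2 * k z)).
  apply/integrableP; split; first by apply/measurable_EFinP; exact: measurable_funTS.
  by under eq_integral do rewrite /= ger0_norm//; rewrite (le_lt_trans eDE)// ltry.
have i2 := integrable_weighted_cross mf fE f2 mK fK mDE.
have i3 : mu2.-integrable (D `*` E) (fun z => 2%:E * (K z * (f z.1 * f z.2))%:E)%E.
  exact: integrableZl.
apply: (@le_trans _ _ (\int[mu2]_(z in D `*` E) (f z.1 ^+ 2 * K z)%:E)%E).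
  rewrite tonelli_setX//; last 2 first.
  - exact/measurable_EFinP.
  - by move=> z; rewrite lee_fin mulr_ge0// sqr_ge0.
  rewrite -ge0_integralZl//; last 2 first.
  - by apply/measurable_EFinP; apply: measurable_funTS; exact: measurable_funX.
  - by move=> x _; rewrite lee_fin sqr_ge0.
  apply: ge0_le_integral => //.
  - by move=> x _; rewrite mule_ge0// lee_fin// sqr_ge0.
  - apply: emeasurable_funM => //.
    by apply/measurable_EFinP; apply: measurable_funTS; exact: measurable_funX.
  - apply: measurable_funTS.
    apply: (measurable_integral_setX (h := fun z => (f z.1 ^+ 2 * K z)%:E)) => //.
      exact/measurable_EFinP.
    by move=> z; rewrite lee_fin mulr_ge0// sqr_ge0.
  move=> x Dx /=; under eq_integral do rewrite EFinM.
  rewrite ge0_integralZl//.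
  - by rewrite muleC lee_wpmul2l// ?NK// lee_fin sqr_ge0.
  - apply/measurable_EFinP; apply: measurable_funTS.
    exact: measurableT_comp.
  - by move=> y _; rewrite lee_fin.
  - by rewrite lee_fin sqr_ge0.
apply: (@le_trans _ _ (\int[mu2]_(z in D `*` E) (((f z.1 - f z.2) ^+ 2 * k z)%:E
    + 2%:E * (K z * (f z.1 * f z.2))%:E))%E).
  apply: ge0_le_integral => //.
  - by move=> z _; rewrite lee_fin mulr_ge0// sqr_ge0.
  - by apply/measurable_EFinP; exact: measurable_funTS.
  - by apply: emeasurable_funD; [case/integrableP: i1|case/integrableP: i3].
  move=> [x y] _ /=; rewrite -EFinM -EFinD lee_fin.
  have /andP[_ Kkz] := Kk (x, y).
  apply: (@le_trans _ _ ((f x - f y) ^+ 2 * K (x, y) + 2 * (K (x, y) * (f x * f y)))).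
    (* The two squares are recovered exactly, and the one in y is dropped. *)
    rewrite (_ : _ + _ = f x ^+ 2 * K (x, y) + f y ^+ 2 * K (x, y)); last by ring.
    by rewrite lerDl mulr_ge0// sqr_ge0.
  by rewrite lerD2r ler_wpM2l// sqr_ge0.
rewrite integralD// integralZl// [leRHS]EFinD.
apply: leeD => //; rewrite EFinM.
by rewrite /Rintegral fineK//; exact: integrable_fin_num.
Qed.

End coercive.

                                           

(** * Extraction of a subsequence and completeness of L^2 *)

(** Finite intersections of members of a free ultrafilter are unbounded, so phi m can be chosen in
    the intersection [W m] of V 0, ..., V m, beyond the previous value. *)
Lemma ultra_diagonal (U : set_system nat) (V : nat -> set nat) :
  UltraFilter U -> \oo `<=` U -> (forall m, U (V m)) ->
  exists phi : nat -> nat, {homo phi : k l / (k < l)%N} /\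
    forall m i, (m <= i)%N -> V m (phi i).
Proof.
move=> UU ooU UV.
pose W := fix W m := if m is m'.+1 then W m' `&` V m else V 0%N.
have UW m : U (W m) by elim: m => [|m IH] /=; [exact: UV|exact: filterI].
have WV m i : (m <= i)%N -> W i `<=` V m.
  elim: i m => [|i IH] m; first by rewrite leqn0 => /eqP ->.
  by rewrite leq_eqVlt => /predU1P[->|mi] x [Wx Vx] //; exact: (IH m).
have /choice[c cP] (mp : nat * nat) : exists k, W mp.1 k /\ (mp.2 < k)%N.
  have Up : U [set k | (mp.2 < k)%N] by apply: ooU; exists mp.2.+1.
  by have [k [Wk pk]] := filter_ex (filterI (UW mp.1) Up); exists k.
pose phi := fix phi m := if m is m'.+1 then c (m, phi m') else c (0, 0)%N.
exists phi; split.
  by apply: homo_ltn => [|i]; [exact: ltn_trans|have [] := cP (i.+1, phi i)].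
move=> m i /WV; apply.
by case: i => [|i]; [case: (cP (0, 0)%N)|case: (cP (i.+1, phi i))].
Qed.

Section l2_complete.
Context d (T : measurableType d) (R : realType).
Variable mu : {measure set T -> \bar R}.
Variable (D : set T) (mD : measurable D).
Hypothesis Dfin : (mu D < +oo)%E.
Variable f : nat -> T -> R.
Hypothesis mf : forall i, measurable_fun setT (f i).
Let t i : R := (2 ^ i.+1)%:R^-1.
Hypothesis cauchy : forall i j, (i <= j)%N ->
  (\int[mu]_(x in D) ((f i x - f j x) ^+ 2)%:E <= (t i ^+ 2)%:E)%E.

Let t0 i : 0 < t i. Proof. by rewrite invr_gt0 ltr0n expn_gt0. Qed.

Let mB i j : measurable_fun D (fun x => f i x - f j x).
Proof. by apply: measurable_funTS; exact: measurable_funB. Qed.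

Let mB2 i j : measurable_fun D (fun x => ((f i x - f j x) ^+ 2)%:E).
Proof. by apply/measurable_EFinP; exact: measurable_funX. Qed.

Let mBa i j : measurable_fun D (fun x => `|f i x - f j x|%:E).
Proof. by apply/measurable_EFinP; exact: measurableT_comp. Qed.

(** The inequality a <= t + a^2/t, with t = 2^-(i+1), trades the L^2 bound t^2 for an L^1 bound of
    order t at the price of the factor mu D + 1. These bounds are summable. *)
Let int_dist i : (\int[mu]_(x in D) `|f i.+1 x - f i x|%:E <=
  ((fine (mu D) + 1) / (2 ^ i.+1)%:R)%:E)%E.
Proof.
                                  
apply: (@le_trans _ _ (\int[mu]_(x in D) ((t i)%:E +
    (t i)^-1%:E * ((f i x - f i.+1 x) ^+ 2)%:E))%E).
  apply: ge0_le_integral => //.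
  - by apply: emeasurable_funD => //; exact: measurable_funeM.
  move=> x _; rewrite -EFinM -EFinD lee_fin distrC.
  rewrite -[X in _ * X]real_normK ?num_real//.
  set a := `|_|; have a0 : 0 <= a by exact: normr_ge0.
  rewrite -(ler_pM2l (t0 i)) mulrDr mulrA divff ?gt_eqF// mul1r.
  by have := sqr_ge0 (t i - a / 2); have := t0 i; nra.
have tV0 : (0 <= (t i)^-1%:E)%E by rewrite lee_fin invr_ge0 ltW.
have sq0 x : D x -> (0 <= ((f i x - f i.+1 x) ^+ 2)%:E)%E.
  by rewrite lee_fin sqr_ge0.
rewrite ge0_integralD//; last 3 first.
- by move=> x _; rewrite lee_fin ltW.
- by move=> x Dx; rewrite mule_ge0// sq0.
- exact: measurable_funeM.
rewrite integral_cst// ge0_integralZl// mulrDl mul1r EFinD leeD//.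
  by rewrite EFinM fineK ?ge0_fin_numE// muleC.
apply: (@le_trans _ _ ((t i)^-1%:E * (t i ^+ 2)%:E)%E).
  by rewrite lee_wpmul2l// cauchy.
by rewrite -EFinM expr2 mulKf ?gt_eqF.
Qed.

Let S x : \bar R := (\sum_(i <oo) `|f i.+1 x - f i x|%:E)%E.

Let S0 x : (0 <= S x)%E.
Proof. exact: nneseries_ge0. Qed.

Let S_fin : {ae mu, forall x, D x -> (S x < +oo)%E}.
Proof.
have Si : mu.-integrable D S.
  apply/integrableP; split.
    exact: ge0_emeasurable_sum.
  under eq_integral do rewrite gee0_abs//.
  rewrite /S integral_nneseries//.
  apply: (@le_lt_trans _ _ (\sum_(i <oo) ((fine (mu D) + 1) / (2 ^ i.+1)%:R)%:E)%E).
    by apply: lee_nneseries => // i _ _; exact: integral_ge0.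
  apply: le_lt_trans (ltry (fine (mu D) + 1)).
  by apply: epsilon_trick0; rewrite addr_ge0.
apply: filterS (integrable_ae mD Si) => x Sx Dx.
by rewrite -ge0_fin_numE// Sx.
Qed.

(** A limit superior is measurable on the whole space, and it equals the limit wherever that
    exists. *)
Let v x : R := fine (limn_esup (fun i => (f i x)%:E)).

Let f_cvg x : (S x < +oo)%E -> f i x @[i --> \oo] --> v x.
Proof.
move=> Sx.
have cs : cvgn (series (telescope (f ^~ x))).
  apply: normed_cvg; apply: nondecreasing_is_cvgn.
    by apply: nondecreasing_series => *; exact: normr_ge0.
  exists (fine (S x)) => _ [n _ <-]; rewrite -lee_fin fineK ?ge0_fin_numE//.
  by rewrite /series/= -sumEFin; exact: nneseries_lim_ge.
have cf : cvgn (f ^~ x).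
  rewrite (_ : f ^~ x = fun n => f 0%N x + series (telescope (f ^~ x)) n).
    by apply: is_cvgD => //; exact: is_cvg_cst.
  by apply/funext => n; rewrite -eq_sum_telescope.
rewrite /v is_cvg_limn_esupE; last first.
  apply/cvg_ex; exists (limn (f ^~ x))%:E; apply: cvg_EFin => //; exact: nearW.
by rewrite EFin_lim.
Qed.

(** Riesz-Fischer: the increments are summable in L^1, hence almost everywhere on D, which gives a
    pointwise limit. Fatou's lemma, applied as j grows, transfers the bound on f_i - f_j to f_i -
    v. *)
Lemma l2_complete : exists2 v : T -> R, measurable_fun setT v &
  (\int[mu]_(x in D) ((f i x - v x) ^+ 2)%:E @[i --> \oo] --> 0)%E.
Proof.
have mv : measurable_fun setT v.
  apply: measurableT_comp => //; apply: measurable_fun_limn_esup => i.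
  exact/measurable_EFinP.
exists v => //.
have mv2 i : measurable_fun D (fun x => ((f i x - v x) ^+ 2)%:E).
  apply/measurable_EFinP; apply: measurable_funTS; apply: measurable_funX.
  exact: measurable_funB.
have le i : (\int[mu]_(x in D) ((f i x - v x) ^+ 2)%:E <= (t i ^+ 2)%:E)%E.
  apply: (@le_trans _ _ (\int[mu]_(x in D)
      limn_einf (fun j => ((f i x - f j x) ^+ 2)%:E))%E).
    apply: ae_ge0_le_integral => //.
    - by move=> x _; rewrite lee_fin sqr_ge0.
    - move=> x _; rewrite limn_einf_lim; apply: lime_ge; first exact: is_cvg_einfs.
      apply: nearW => n; apply: le_ereal_inf_tmp => _ [m _ <-].
      by rewrite lee_fin sqr_ge0.
    - rewrite (_ : (fun x => _) = (fun x =>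
          - limn_esup (fun j => - ((f i x - f j x) ^+ 2)%:E))%E).
        apply: measurableT_comp => //; apply: measurable_fun_limn_esup => j.
        exact: measurableT_comp.
      apply/funext => x.
      by rewrite -[LHS]oppeK; congr (- _)%E; rewrite -limn_esupN.
    apply: filterS S_fin => x Sx Dx.
    have /cvg_limn_einf_sup [-> _] // :
        (((f i x - f j x) ^+ 2)%:E @[j --> \oo] --> ((f i x - v x) ^+ 2)%:E)%E.
    apply: cvg_EFin; first exact: nearW.
    have fv : f i x - f j x @[j --> \oo] --> f i x - v x.
      by apply: cvgB; [exact: cvg_cst|exact/f_cvg/Sx].
    by rewrite expr2; under eq_fun do rewrite /= expr2; exact: (cvgM fv fv).
  apply: (le_trans (fatou mu mD _ _)) => //.
    by move=> j x _; rewrite lee_fin sqr_ge0.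
  rewrite limn_einf_lim; apply: lime_le; first exact: is_cvg_einfs.
  apply: nearW => n; apply: le_trans (cauchy (leq_maxr n i)).
  by apply: ereal_inf_lbound; exists (maxn n i) => //=; exact: leq_maxl.
apply: (@squeeze_cvge _ _ _ _ (cst 0)%E _ (fun i => (t i ^+ 2)%:E)).
- by apply: nearW => i; rewrite le integral_ge0// => x _; rewrite lee_fin sqr_ge0.
- exact: cvg_cst.
apply: cvg_EFin; first exact: nearW.
rewrite (_ : _ \o _ = geometric 4^-1 4^-1).
  by apply: cvg_geometric; rewrite ger0_norm// invf_lt1// ltr1n.
apply/funext => i /=; rewrite /t natrX -exprVn -exprM mulnC exprM -exprS.
by congr (_ ^+ _); rewrite expr2 -invfM -natrM.
Qed.

End l2_complete.

(** This is (a - b)^2 <= 2 a^2 + 2 b^2. The weight is 1 for L^2 norms and the kernel for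
    energies. *)
Lemma ge0_integral_sqrB_le d (T : measurableType d) (R : realType)
    (mu : {measure set T -> \bar R}) (D : set T) (f g w : T -> R) (A B : R) :
  measurable D -> measurable_fun D f -> measurable_fun D g -> measurable_fun D w ->
  (forall x, D x -> 0 <= w x) ->
  (\int[mu]_(x in D) (f x ^+ 2 * w x)%:E <= A%:E)%E ->
  (\int[mu]_(x in D) (g x ^+ 2 * w x)%:E <= B%:E)%E ->
  (\int[mu]_(x in D) ((f x - g x) ^+ 2 * w x)%:E <= (2 * (A + B))%:E)%E.
Proof.
move=> mD mf mg mw w0 fA gB.
have mfw : measurable_fun D (fun x => (f x ^+ 2 * w x)%:E).
  by apply/measurable_EFinP; apply: measurable_funM => //; exact: measurable_funX.
have mgw : measurable_fun D (fun x => (g x ^+ 2 * w x)%:E).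
  by apply/measurable_EFinP; apply: measurable_funM => //; exact: measurable_funX.
have fw0 x : D x -> (0 <= (f x ^+ 2 * w x)%:E)%E.
  by move=> Dx; rewrite lee_fin mulr_ge0 ?sqr_ge0 ?w0.
have gw0 x : D x -> (0 <= (g x ^+ 2 * w x)%:E)%E.
  by move=> Dx; rewrite lee_fin mulr_ge0 ?sqr_ge0 ?w0.
apply: (@le_trans _ _ (\int[mu]_(x in D)
    (2%:E * ((f x ^+ 2 * w x)%:E + (g x ^+ 2 * w x)%:E)))%E).
  apply: ge0_le_integral => //.
  - by move=> x Dx; rewrite lee_fin mulr_ge0 ?sqr_ge0 ?w0.
  - apply/measurable_EFinP; apply: measurable_funM => //; apply: measurable_funX.
    exact: measurable_funB.
  - by apply: measurable_funeM; exact: emeasurable_funD.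
  move=> x Dx; rewrite -EFinD -EFinM lee_fin -mulrDl mulrA ler_wpM2r ?w0//.
  by have := sqr_ge0 (f x + g x); nra.
rewrite ge0_integralZl//; last 2 first.
- exact: emeasurable_funD.
- by move=> x Dx; rewrite adde_ge0 ?fw0 ?gw0.
by rewrite ge0_integralD// EFinM lee_wpmul2l// EFinD leeD.
Qed.

(** * The abstract compactness criterion *)

Section compactness.
Context d (T : measurableType d) (R : realType).
Variable mu : {sigma_finite_measure set T -> \bar R}.
Local Notation mu2 := (mu \x mu)%E.
Variables (D E : set T).
Hypotheses (mD : measurable D) (mE : measurable E) (DE : D `<=` E)
  (Efin : (mu E < +oo)%E).
Variable k : T * T -> R.
Hypotheses (mk : measurable_fun setT k) (k0 : forall z, 0 <= k z).
Hypothesis kN : forall N : R, exists K : T * T -> R,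
  [/\ measurable_fun setT K, finite_set (range K), forall z, 0 <= K z <= k z &
      forall x, D x -> (N%:E <= \int[mu]_(y in E) (K (x, y))%:E)%E].
Variables (f : nat -> T -> R) (A : R).
Hypotheses (mf : forall i, measurable_fun setT (f i))
  (fE : forall i x, ~ E x -> f i x = 0)
  (fA : forall i, (\int[mu]_x (f i x ^+ 2)%:E <= A%:E)%E)
  (fkA : forall i, (\int[mu2]_(z in E `*` E)
    ((f i z.1 - f i z.2) ^+ 2 * k z)%:E <= A%:E)%E).

Let fi i : mu.-integrable setT (EFin \o f i).
Proof.
apply: (integrable_sqr_support mE) => //; first exact: fE.
exact: le_lt_trans (fA i) (ltry _).
Qed.

Let A0 : 0 <= A.
Proof.
rewrite -lee_fin (le_trans _ (fA 0))// integral_ge0// => x _.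
by rewrite lee_fin sqr_ge0.
Qed.

(** From |a| <= 1 + a^2 on E; the bound is what makes these integrals converge along an
    ultrafilter. *)
Let int_bounded B i : measurable B ->
  `|\int[mu]_(x in B) f i x| <= fine (mu E) + A.
Proof.
move=> mB.
have fB : mu.-integrable B (EFin \o f i) by exact: (integrableS measurableT).
rewrite -lee_fin EFin_normr_Rintegral//.
apply: (le_trans (le_abse_integral _ mB _)); first by case/integrableP: fB.
apply: (@le_trans _ _ (\int[mu]_x ((\1_E x)%:E + (f i x ^+ 2)%:E))%E).
  apply: (@le_trans _ _ (\int[mu]_x `|(f i x)%:E|)%E).
    apply: ge0_subset_integral => //.
    by apply: measurableT_comp => //; exact/measurable_EFinP.
  apply: ge0_le_integral => //.
  - by apply: measurableT_comp => //; exact/measurable_EFinP.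
  - apply: emeasurable_funD; apply/measurable_EFinP; first exact: measurable_indic.
    exact: measurable_funX.
  move=> x _; rewrite abse_EFin -EFinD lee_fin indicE.
  have [xE|xE] := boolP (x \in E); last first.
    by rewrite fE ?normr0 ?expr0n ?addr0//; move/mem_set; exact/negP.
  rewrite -[X in _ + X]real_normK ?num_real//=.
  have := sqr_ge0 (`|f i x| - 1); have := normr_ge0 (f i x); nra.
rewrite ge0_integralD//.
- rewrite integral_indic// setIT EFinD leeD//.
  by rewrite fineK// ge0_fin_numE.
- by apply/measurable_EFinP; exact: measurable_indic.
- by move=> x _; rewrite lee_fin sqr_ge0.
- by apply/measurable_EFinP; exact: measurable_funX.
Qed.

(** The coercivity estimate for f_i - f_j: the energy part is divided by a large N, and the cross
    part tends to 0 along the product filter U x U. *)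
Lemma ultra_l2_cauchy (U : set_system nat) (e : R) : UltraFilter U -> 0 < e ->
  exists2 V, U V & forall i j, V i -> V j ->
    (\int[mu]_(x in D) ((f i x - f j x) ^+ 2)%:E <= e%:E)%E.
Proof.
move=> UU e0.
pose g (p : nat * nat) x := f p.1 x - f p.2 x.
pose F : set_system (nat * nat) := filter_prod U U.
have FF : Filter F by exact: filter_prod_filter.
have mg p : measurable_fun setT (g p) by exact: measurable_funB.
have gE p x : ~ E x -> g p x = 0 by move=> Ex; rewrite /g !fE// subrr.
have A4 : 2 * (A + A) = 4 * A by ring.
have gA p : (\int[mu]_x (g p x ^+ 2)%:E <= (4 * A)%:E)%E.
  have one (h : T -> R) :
      (\int[mu]_x (h x ^+ 2)%:E = \int[mu]_x (h x ^+ 2 * cst 1 x)%:E)%E.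
    by apply: eq_integral => x _; rewrite mulr1.
  by rewrite -A4 one; apply: ge0_integral_sqrB_le => //; rewrite -one.
(* Both integrals converge along U to the same limit l, so their difference tends to 0. *)
have gw B : measurable B -> \int[mu]_(x in B) g p x @[p --> F] --> (0:R).
  move=> mB.
  have /cvg_ex[l fl] := @ultra_bounded_cvg R nat U _ _ UU (fun i => int_bounded i mB).
  rewrite (_ : (fun p => _) = fun p : nat * nat =>
      \int[mu]_(x in B) f p.1 x - \int[mu]_(x in B) f p.2 x); last first.
    by apply/funext => p; rewrite RintegralB//; exact: (integrableS measurableT).
  rewrite -(subrr l); apply: cvgB.
    exact: (cvg_comp fst (fun i => \int[mu]_(x in B) f i x) cvg_fst fl).
  exact: (cvg_comp snd (fun i => \int[mu]_(x in B) f i x) cvg_snd fl).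
(* The energy of a difference is at most 4A, and the cross term, once at most 1 in absolute value,
   enters twice; dividing 4A + 2 by N gives e. *)
pose N := (4 * A + 2) / e.
have N0 : 0 < N by rewrite divr_gt0// ltr_wpDl// mulr_ge0.
have [K [mK fK Kk NK]] := kN N.
have mDE : measurable (D `*` E) by exact: measurableX.
have := weak_weighted_cross_cvg mE Efin FF mg gE gA gw mK fK mDE.
move=> /cvgr0Pnorm_le /(_ _ ltr01) [[V1 V2] /= [UV1 UV2] V12].
(* A member of the product filter contains a rectangle V1 x V2; in the intersection every pair (i,
   j) lies in it. *)
exists (V1 `&` V2); first exact: filterI.
move=> i j [V1i _] [_ V2j].
have small : `|\int[mu2]_(z in D `*` E) (K z * (g (i, j) z.1 * g (i, j) z.2))| <= 1.
  exact: (V12 (i, j)).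
have := @coercive_bound _ _ _ mu D E mD mE DE Efin k mk k0 (g (i, j)) K N (4 * A)
  (mg _) (gE _) (le_lt_trans (gA _) (ltry _)) mK fK Kk (ltW N0) NK.
have -> : (\int[mu2]_(z in E `*` E) ((g (i, j) z.1 - g (i, j) z.2) ^+ 2 * k z)%:E
    <= (4 * A)%:E)%E.
  rewrite -A4 (_ : (fun z => _) = fun z : T * T =>
    (((f i z.1 - f i z.2) - (f j z.1 - f j z.2)) ^+ 2 * k z)%:E); last first.
    by apply/funext => z; rewrite /g/=; congr ((_ ^+ 2 * _)%:E); ring.
  have m12 l : measurable_fun setT (fun z : T * T => f l z.1 - f l z.2).
    by apply: measurable_funB; exact: measurableT_comp.
  apply: ge0_integral_sqrB_le => //; [exact: measurableX|exact: measurable_funTS..].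
move=> /(_ isT) h.
rewrite -(@lee_pmul2l _ N%:E)// (le_trans h)// -EFinM lee_fin /N divfK ?gt_eqF//.
by rewrite lerD2l; move: small; rewrite ler_norml => /andP[_]; lra.
Qed.

(** Along a free ultrafilter the sequence is Cauchy with any prescribed error. The errors 4^-(m+1)
    let the diagonal subsequence meet the rate that [l2_complete] asks for. *)
Lemma l2_subsequence : exists phi : nat -> nat,
  {homo phi : i j / (i < j)%N} /\
  exists2 v : T -> R, measurable_fun setT v &
  (\int[mu]_(x in D) ((f (phi i) x - v x) ^+ 2)%:E @[i --> \oo] --> 0)%E.
Proof.
have [U [UU ooU]] := @ultraFilterLemma nat \oo _.
pose t i : R := (2 ^ i.+1)%:R^-1.
have t0 i : 0 < t i ^+ 2 by rewrite exprn_gt0// invr_gt0 ltr0n expn_gt0.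
have /choice[V VP] m : exists V, U V /\ forall i j, V i -> V j ->
    (\int[mu]_(x in D) ((f i x - f j x) ^+ 2)%:E <= (t m ^+ 2)%:E)%E.
  by have [V UV h] := ultra_l2_cauchy UU (t0 m); exists V.
have [phi [phiS phiV]] := ultra_diagonal UU ooU (fun m => proj1 (VP m)).
exists phi; split => //; apply: (l2_complete mD) => //.
  by rewrite (le_lt_trans _ Efin)// le_measure ?inE.
move=> i j ij; apply: (proj2 (VP i)); apply: phiV => //.
Qed.

End compactness.

                                                       

(** * Measure-preserving maps and translation invariance of Lebesgue measure *)

Section measure_preserving.
Context d (T : measurableType d) (R : realType).
Variable mu : {measure set T -> \bar R}.

Definition measure_preserving (phi : T -> T) :=
  measurable_fun setT phi /\
  forall A, measurable A -> mu (phi @^-1` A) = mu A.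

Lemma ge0_integral_preserving (phi : T -> T) (A : set T) (f : T -> \bar R) :
  measure_preserving phi -> measurable A -> measurable_fun A f ->
  (forall x, A x -> 0 <= f x)%E ->
  (\int[mu]_(x in A) f x = \int[mu]_(x in phi @^-1` A) f (phi x))%E.
Proof.
move=> [mphi phiE] mA mf f0.
rewrite -(@ge0_integral_pushforward _ _ _ _ _ phi mphi)//; last first.
  by move=> x; rewrite inE => /f0.
pose phi' : {mfun T >-> T} := HB.pack phi (isMeasurableFun.Build _ _ _ _ _ mphi).
apply: (@eq_measure_integral _ _ _ _ (pushforward mu phi' : {measure set T -> \bar R})).
by move=> B mB _; rewrite -phiE.
Qed.

End measure_preserving.

(** The image of the product measure agrees with it on rectangles, so uniqueness of the product
    measure applies. *)
Lemma measure_preserving_prod d1 d2 (T1 : measurableType d1)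
    (T2 : measurableType d2) (R : realType)
    (m1 : {sigma_finite_measure set T1 -> \bar R})
    (m2 : {sigma_finite_measure set T2 -> \bar R}) phi1 phi2 :
  measure_preserving m1 phi1 -> measure_preserving m2 phi2 ->
  measure_preserving (m1 \x m2)%E (fun p => (phi1 p.1, phi2 p.2)).
Proof.
move=> [mphi1 phi1E] [mphi2 phi2E].
have mphi : measurable_fun setT (fun p : T1 * T2 => (phi1 p.1, phi2 p.2)).
  by apply: measurable_fun_pair; exact: measurableT_comp.
split => // A mA.
pose phi : {mfun (T1 * T2)%type >-> (T1 * T2)%type} :=
  HB.pack (fun p : T1 * T2 => (phi1 p.1, phi2 p.2))
    (isMeasurableFun.Build _ _ _ _ _ mphi).
rewrite [RHS](@product_measure_unique _ _ _ _ _ m1 m2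
  (pushforward (m1 \x m2)%E phi))// => A1 A2 mA1 mA2.
rewrite [LHS](_ : _ = (m1 \x m2)%E ((phi1 @^-1` A1) `*` (phi2 @^-1` A2)))//.
rewrite product_measure1E ?phi1E ?phi2E//.
- by rewrite -[X in measurable X]setTI; exact: mphi1.
- by rewrite -[X in measurable X]setTI; exact: mphi2.
Qed.

Section lebesgue_translation.
Context {R : realType}.

Lemma lebesgue_measure_translation (c : R) :
  measure_preserving (@lebesgue_measure R) (fun x => x + c).
Proof.
have mc : @measurable_fun _ _ (measurableTypeR R) (measurableTypeR R) setT
    (fun x => x + c).
  exact: (@measurable_funD _ R R setT id (cst c)).
split => // A mA.
pose phi : {mfun measurableTypeR R >-> measurableTypeR R} :=
  HB.pack (fun x : measurableTypeR R => x + c) (isMeasurableFun.Build _ _ _ _ _ mc).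
apply/esym; apply: (@lebesgue_measure_unique R (pushforward lebesgue_measure phi)) => //.
move=> _ [[a b] _ <-]; rewrite /pushforward/=.
transitivity (lebesgue_measure (`]a - c, b - c]%classic : set R)).
  rewrite !lebesgue_measure_itv/= !lte_fin ltrBlDr subrK.
  by case: ifPn => // _; rewrite -!EFinB; congr _%:E; ring.
by congr (lebesgue_measure _); apply/seteqP; split => x /=;
  rewrite !in_itv/= ltrBlDr lerBrDr.
Qed.

Lemma measurable_rV_add n (c : 'rV[R]_n) :
  measurable_fun setT (fun x : 'rV[R]_n => x + c).
Proof.
apply: measurable_fun_rVP => i.
rewrite (_ : _ \o _ = fun x : 'rV[R]_n => rV_coord i x + c ord0 i).
  by apply: measurable_funD => //; exact: measurable_rV_coord.
by apply/funext => x; rewrite /rV_coord/= mxE.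
Qed.

(** Induction on the dimension: through [rV_cons] a translation becomes the product of a translation
    of the line and one in lower dimension. *)
Lemma lebesgue_rV_translation n (c : 'rV[R]_n) :
  measure_preserving (lebesgue_rV R n) (fun x => x + c).
Proof.
split; first exact: measurable_rV_add.
elim: n c => [|n IH] c A mA.
  congr (_ _); apply/seteqP; split => x /=;
    by rewrite (_ : x + c = x)//; apply/rowP => -[].
pose c0 := c ord0 ord0; pose c' : 'rV[R]_n := \row_i c ord0 (lift ord0 i).
pose tau (p : R * 'rV[R]_n) : R * 'rV[R]_n := (p.1 + c0, p.2 + c').
have [_ tauE] := measure_preserving_prod
  (lebesgue_measure_translation c0) (conj (measurable_rV_add c') (IH c')).
rewrite /= /lebesgue_rV_step /pushforward -[RHS]tauE; last first.
  by rewrite -[X in measurable X]setTI; exact: measurable_rV_cons.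
congr (_ _); apply/seteqP; split=> p /=;
  rewrite (_ : rV_cons p + c = rV_cons (tau p))//;
  apply/rowP => i; rewrite mxE;
  (have [->|[j ->]] : i = ord0 \/ exists j, i = lift ord0 j by
    case: (unliftP ord0 i) => [j ->|->]; [right; exists j|left]).
all: by rewrite ?rV_cons0 ?rV_consS// mxE mxE.
Qed.

End lebesgue_translation.

(** * Continuity and measurability on R^n, and the Euclidean norm *)

Section rV_continuous.
Context {R : realType}.

Lemma continuous_sum (T : topologicalType) (I : Type) (s : seq I) (f : I -> T -> R) :
  (forall i, continuous (f i)) -> continuous (fun x => \sum_(i <- s) f i x).
Proof.
move=> cf; elim: s => [|a s IH] x.
  rewrite (_ : (fun x => _) = cst 0); first exact: cvg_cst.
  by apply/funext => y; rewrite big_nil.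
rewrite (_ : (fun x => _) = (fun x => f a x + \sum_(i <- s) f i x)).
  by apply: cvgD; [exact: cf|exact: IH].
by apply/funext => y; rewrite big_cons.
Qed.

Lemma continuous_rVP (T : topologicalType) n (f : T -> 'rV[R]_n) :
  (forall i, continuous (fun x => f x ord0 i)) -> continuous f.
Proof.
move=> cf x; apply/cvgrPdist_lt => e e0.
have : \forall y \near x, forall i, `|f x ord0 i - f y ord0 i| < e.
  by apply: filter_forall => i; have /cvgrPdist_lt/(_ _ e0) := cf i x.
apply: filterS => y xy.
suff : ball (f x) e (f y) by rewrite -ball_normE.
by split => // i j; rewrite ord1; exact: xy.
Qed.

Lemma mulmx_rV_continuous m n (Q : 'M[R]_(m, n)) :
  continuous (fun x : 'rV[R]_m => x *m Q).
Proof.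
apply: continuous_rVP => i; under eq_fun do rewrite mxE.
apply: continuous_sum => j x.
exact: cvgMr_tmp (@coord_continuous R 1 m ord0 j x).
Qed.

Lemma enorm_sqr n (x : 'rV[R]_n) : enorm x ^+ 2 = \sum_i x ord0 i ^+ 2.
Proof. by rewrite sqr_sqrtr// sumr_ge0// => i _; exact: sqr_ge0. Qed.

Lemma enorm_ge0 n (x : 'rV[R]_n) : 0 <= enorm x.
Proof. exact: sqrtr_ge0. Qed.

Lemma enorm0 n : enorm (0 : 'rV[R]_n) = 0.
Proof. by rewrite /enorm big1 ?sqrtr0// => i _; rewrite mxE expr0n. Qed.

Lemma enormN n (x : 'rV[R]_n) : enorm (- x) = enorm x.
Proof. by congr Num.sqrt; apply: eq_bigr => i _; rewrite mxE sqrrN. Qed.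

Lemma enormZ n (c : R) (x : 'rV[R]_n) : enorm (c *: x) = `|c| * enorm x.
Proof.
rewrite /enorm (eq_bigr (fun i => c ^+ 2 * x ord0 i ^+ 2)).
  by rewrite -mulr_sumr sqrtrM ?sqr_ge0// sqrtr_sqr.
by move=> i _; rewrite mxE exprMn.
Qed.

Lemma coord_le_enorm n (x : 'rV[R]_n) i : `|x ord0 i| <= enorm x.
Proof.
rewrite -sqrtr_sqr ler_sqrt ?sumr_ge0//; last by move=> j _; exact: sqr_ge0.
by rewrite (bigD1 i)//= lerDl sumr_ge0// => j _; exact: sqr_ge0.
Qed.

Lemma enorm_eq0 n (x : 'rV[R]_n) : (enorm x == 0) = (x == 0).
Proof.
apply/idP/idP => [/eqP x0|/eqP ->]; last by rewrite enorm0.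
apply/eqP/rowP => i; rewrite mxE; apply/eqP; rewrite -normr_le0.
by rewrite -x0 coord_le_enorm.
Qed.

Lemma mxnorm_le_enorm n (x : 'rV[R]_n) : `|x| <= enorm x.
Proof.
change (mx_norm x <= enorm x).
have [->|] := eqVneq (mx_norm x) 0; first exact: enorm_ge0.
by move=> /mx_norm_neq0[[i j] ->] /=; rewrite ord1 coord_le_enorm.
Qed.

Lemma enorm_mulmx n (Q : 'M[R]_n) (x : 'rV[R]_n) : Q *m Q^T = 1%:M ->
  enorm (x *m Q) = enorm x.
Proof.
have eE (y : 'rV[R]_n) : \sum_i y ord0 i ^+ 2 = (y *m y^T) ord0 ord0.
  by rewrite mxE; apply: eq_bigr => i _; rewrite mxE expr2.
move=> QQ; rewrite /enorm !eE trmx_mul !mulmxA.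
by rewrite -(mulmxA x Q Q^T) QQ mulmx1.
Qed.

Lemma enorm_continuous n : continuous (@enorm R n).
Proof.
move=> x; apply: (@continuous_comp _ _ _ (fun x : 'rV[R]_n => \sum_i x ord0 i ^+ 2)).
  apply: continuous_sum => i y.
  exact: (cvgM (@coord_continuous R 1 n ord0 i y) (@coord_continuous R 1 n ord0 i y)).
exact: sqrt_continuous.
Qed.

Lemma open_measurable_rV n (U : set 'rV[R]_n) : open U -> measurable U.
Proof. by move=> oU; rewrite measurable_rVE; exact: sub_sigma_algebra. Qed.

Lemma measurable_enorm_sqr n : measurable_fun setT (fun x : 'rV[R]_n => enorm x ^+ 2).
Proof.
under eq_fun do rewrite enorm_sqr.
by apply: measurable_sum => i; apply: measurable_funX; exact: measurable_rV_coord.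
Qed.

Lemma open_enorm_lt n (r : R) : open [set x : 'rV[R]_n | enorm x < r].
Proof.
apply: (@open_comp _ _ (@enorm R n) [set y | y < r]); last exact: open_lt.
by move=> x _; exact: enorm_continuous.
Qed.

Lemma measurable_rV_mulmx m n (Q : 'M[R]_(m, n)) :
  measurable_fun setT (fun x : 'rV[R]_m => x *m Q).
Proof.
apply: measurable_fun_rVP => i.
rewrite (_ : _ \o _ = fun x : 'rV[R]_m => \sum_j rV_coord j x * Q j i).
  by apply: measurable_sum => j; apply: measurable_funM => //; exact: measurable_rV_coord.
by apply/funext => x; rewrite /rV_coord/= mxE.
Qed.

Lemma measurable_rV_fun_add d (T : measurableType d) n (f g : T -> 'rV[R]_n) :
  measurable_fun setT f -> measurable_fun setT g ->
  measurable_fun setT (fun x => f x + g x).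
Proof.
move=> mf mg; apply: measurable_fun_rVP => i.
rewrite (_ : _ \o _ = fun x => rV_coord i (f x) + rV_coord i (g x)).
  by apply: measurable_funD; apply: measurableT_comp => //; exact: measurable_rV_coord.
by apply/funext => x; rewrite /rV_coord/= mxE.
Qed.

Lemma measurable_rV_opp n : measurable_fun setT (fun x : 'rV[R]_n => - x).
Proof.
apply: measurable_fun_rVP => i.
rewrite (_ : _ \o _ = fun x : 'rV[R]_n => - rV_coord i x).
  by apply: measurableT_comp => //; exact: measurable_rV_coord.
by apply/funext => x; rewrite /rV_coord/= mxE.
Qed.

End rV_continuous.

(** * Rotation invariance of Lebesgue measure *)

Section orthogonal.
Context {R : realType} {n : nat}.
Local Notation leb := (lebesgue_rV R n).
Local Notation B1 := [set x : 'rV[R]_n | enorm x < 1].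

Let mB1 : measurable B1.
Proof. by apply: open_measurable_rV; exact: open_enorm_lt. Qed.

Let box (c : R) := [set x : 'rV[R]_n | forall i, `]-c, c[%classic (x ord0 i)].

Let boxE (c : R) : 0 < c -> leb (box c) = ((2 * c) ^+ n)%:E.
Proof.
move=> c0; rewrite [LHS](@lebesgue_rV_prod R n (fun=> `]-c, c[%classic)); last first.
  by move=> i; exact: measurable_itv.
rewrite (eq_bigr (fun=> (2 * c)%:E)); last first.
  move=> i _; rewrite lebesgue_measure_itv/= lte_fin ifT ?gtrN//.
  by rewrite -EFinB; congr _%:E; ring.
by rewrite prodEFin prodr_const card_ord.
Qed.

Let mbox c : measurable (box c).
Proof.
rewrite (_ : box c = \bigcap_(i in [set: 'I_n]) (rV_coord i @^-1` `]-c, c[%classic)).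
  apply: fin_bigcap_measurable => // i _.
  by rewrite -[X in measurable X]setTI; exact: measurable_rV_coord.
by apply/seteqP; split => x /= h i; [move=> _|]; exact: h.
Qed.

Lemma lebesgue_ball_lty : (leb B1 < +oo)%E.
Proof.
apply: (@le_lt_trans _ _ (leb (box 1))); last by rewrite boxE// ltry.
apply: le_measure; rewrite ?inE// => x /= x1 i.
by rewrite /= in_itv/= -ltr_norml; exact: le_lt_trans (coord_le_enorm _ _) x1.
Qed.

Lemma lebesgue_ball_gt0 : (0 < leb B1)%E.
Proof.
have c0 : 0 < n.+1%:R^-1 :> R by rewrite invr_gt0.
(* The open cube of half-side 1/(n+1) lies in the unit ball: n squares, each at most 1/(n+1), add up
   to less than 1. *)
apply: (@lt_le_trans _ _ (leb (box n.+1%:R^-1))).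
  by rewrite boxE// lte_fin exprn_gt0// mulr_gt0.
apply: le_measure; rewrite ?inE// => x /= xc.
rewrite -[ltRHS]sqrtr1 ltr_sqrt//.
apply: (@le_lt_trans _ _ (\sum_(i < n) n.+1%:R^-1)).
  apply: ler_sum => i _; rewrite -real_normK ?num_real//.
  have := xc i; rewrite /= in_itv/= -ltr_norml => /ltW xi.
  apply: (@le_trans _ _ (n.+1%:R^-1 * 1)); last by rewrite mulr1.
  rewrite expr2; apply: ler_pM => //.
  by rewrite (le_trans xi)// invf_le1 ?ler1n// ltr0n.
by rewrite sumr_const card_ord -[ltLHS]mulr_natl ltr_pdivrMr// mul1r ltr_nat.
Qed.

                                                                                
                                                                                
                                                                          
(** A double-counting argument that uses no determinant. The set [S] of pairs (x, y) with |x| < 1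
    and x + yQ in B has measure leb(B1) times that of the preimage of B. Translating each slice at
    fixed y by yQ turns [S] into [S'], whose measure is leb(B) leb(B1) because the unit ball is
    rotation invariant. Then leb(B1), positive and finite, cancels. *)
Lemma orthogonal_preserving (Q : 'M[R]_n) : Q *m Q^T = 1%:M ->
  measure_preserving leb (fun x => x *m Q).
Proof.
move=> QQ; have mQ := measurable_rV_mulmx Q; split=> // B mB.
have QTQ : Q^T *m Q = 1%:M by exact: mulmx1C.
have shift c : measure_preserving leb (fun x => x + c).
  exact: lebesgue_rV_translation.
pose S := [set p : 'rV[R]_n * 'rV[R]_n | B1 p.1 /\ B (p.1 + p.2 *m Q)].
pose S' := [set p : 'rV[R]_n * 'rV[R]_n | B1 (p.1 - p.2 *m Q) /\ B p.1].
have mQB : measurable ((fun x => x *m Q) @^-1` B).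
  by rewrite -[X in measurable X]setTI; exact: mQ.
have mNQ : measurable_fun setT (fun x : 'rV[R]_n => - (x *m Q)).
  exact: (measurableT_comp (@measurable_rV_opp R n) mQ).
have mNQB1 : measurable ((fun x : 'rV[R]_n => - (x *m Q)) @^-1` B1).
  by rewrite -[X in measurable X]setTI; exact: mNQ.
have mpQ : measurable_fun setT (fun p : 'rV[R]_n * 'rV[R]_n => p.2 *m Q).
  exact: (measurableT_comp mQ).
have mD1 : measurable_fun setT (fun p : 'rV[R]_n * 'rV[R]_n => p.1 + p.2 *m Q).
  exact: measurable_rV_fun_add measurable_fst mpQ.
have mD2 : measurable_fun setT (fun p : 'rV[R]_n * 'rV[R]_n => p.1 - p.2 *m Q).
  apply: measurable_rV_fun_add measurable_fst _.
  exact: (measurableT_comp (@measurable_rV_opp R n) mpQ).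
have mS : measurable S.
  apply: measurableI.
    by rewrite -[X in measurable X]setTI; exact: (measurable_fst measurableT).
  by rewrite -[X in measurable X]setTI; exact: (mD1 measurableT _ mB).
have mS' : measurable S'.
  apply: measurableI; last first.
    by rewrite -[X in measurable X]setTI; exact: (measurable_fst measurableT).
  by rewrite -[X in measurable X]setTI; exact: (mD2 measurableT _ mB1).
have SE : (leb \x leb)%E S = (leb B1 * leb ((fun x => x *m Q) @^-1` B))%E.
  rewrite /product_measure1/=.
  rewrite (eq_integral (fun x => (\1_B1 x)%:E * leb ((fun x => x *m Q) @^-1` B))%E).
    rewrite ge0_integralZr ?integral_indic ?setIT//.
    by apply/measurable_EFinP; exact: measurable_indic.
  move=> x _ /=; rewrite indicE; have [xA|xA] := boolP (x \in B1); last first.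
    rewrite mul0e (_ : xsection S x = set0) ?measure0//.
    by apply/seteqP; split=> y //; rewrite /xsection/= inE => -[xB _];
      move: xA; rewrite notin_setE.
  rewrite mul1e -(proj2 (shift (x *m Q^T)) _ mQB); congr (leb _).
  apply/seteqP; split=> y; rewrite /xsection/= inE /= mulmxDl -mulmxA QTQ mulmx1 addrC.
    by case.
  by move=> By; split => //; rewrite inE in xA.
have S'E : (leb \x leb)%E S' = (leb B * leb B1)%E.
  rewrite /product_measure1/=.
  rewrite (eq_integral (fun x => (\1_B x)%:E * leb B1)%E).
    rewrite ge0_integralZr ?integral_indic ?setIT//.
    by apply/measurable_EFinP; exact: measurable_indic.
  move=> x _ /=; rewrite indicE; have [xB|xB] := boolP (x \in B); last first.
    rewrite mul0e (_ : xsection S' x = set0) ?measure0//.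
    by apply/seteqP; split=> y //; rewrite /xsection/= inE => -[_ Bx];
      move: xB; rewrite notin_setE.
  rewrite mul1e (_ : B1 = (fun x : 'rV[R]_n => - (x *m Q)) @^-1` B1); last first.
    by apply/seteqP; split => y /=; rewrite enormN enorm_mulmx.
  rewrite -(proj2 (shift (- (x *m Q^T))) _ mNQB1); congr (leb _).
  apply/seteqP; split=> y; rewrite /xsection/= inE /= mulmxDl mulNmx -mulmxA QTQ
    mulmx1 opprD opprK addrC.
    by case.
  by move=> By; split => //; rewrite inE in xB.
(* Here the measures are computed by slices at fixed y, where [S] and [S'] differ by a
   translation. *)
have SS' : (leb \x leb)%E S = (leb \x leb)%E S'.
  rewrite -(setIT S) -(setIT S') -!integral_indic// ?measurableT//.
  rewrite (indic_fubini_tonelli1 leb leb mS) (indic_fubini_tonelli1 leb leb mS').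
  rewrite (indic_fubini_tonelli leb leb mS) (indic_fubini_tonelli leb leb mS').
  rewrite indic_fubini_tonelli_GE// indic_fubini_tonelli_GE//.
  apply: eq_integral => y _ /=.
  rewrite -[RHS](proj2 (shift (y *m Q))); last exact: measurable_ysection.
  congr (leb _); apply/seteqP; split=> x; rewrite /ysection/= !inE /S /S' /= addrK.
    by [].
  by [].

move: SS'; rewrite SE S'E muleC.
have Bfin : leb B1 \is a fin_num by rewrite ge0_fin_numE// lebesgue_ball_lty.
have le := lee_pmul2r Bfin lebesgue_ball_gt0.
by move=> E; apply/eqP; rewrite eq_le -(le (leb _)) -[X in _ && X]le E lexx.
Qed.

End orthogonal.

(** * Cones carry infinite mass of a radial kernel *)

Section cone.
Context {R : realType}.

Lemma enorm_dot n (x : 'rV[R]_n) : (x *m x^T) = (enorm x ^+ 2)%:M.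
Proof.
rewrite [LHS]mx11_scalar enorm_sqr mxE; congr _%:M.
by apply: eq_bigr => i _; rewrite mxE expr2.
Qed.

                                                    
(** For x different from y, [P] is the Householder reflection in the hyperplane orthogonal to w = x
    - y; equality of the norms gives x.w = |w|^2 / 2, so x is sent to x - w = y. *)
Lemma orthogonal_transitive n (x y : 'rV[R]_n) : enorm x = enorm y ->
  exists2 P : 'M[R]_n, P *m P^T = 1%:M & x *m P = y.
Proof.
move=> xy; have [->|] := eqVneq x y.
  by exists 1%:M; rewrite ?trmx1 ?mulmx1.
rewrite -subr_eq0; move wE : (x - y) => w w0.
have s0 : enorm w ^+ 2 != 0 by rewrite sqrf_eq0 enorm_eq0.
pose c := 2 / enorm w ^+ 2; pose P : 'M[R]_n := 1%:M - c *: (w^T *m w).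
have PT : P^T = P by rewrite /P linearB/= linearZ/= trmx1 trmx_mul trmxK.
exists P.
  have WW : (w^T *m w) *m (w^T *m w) = enorm w ^+ 2 *: (w^T *m w).
    by rewrite mulmxA -(mulmxA w^T) enorm_dot mul_mx_scalar scalemxAl.
  rewrite PT /P mulmxBl mul1mx mulmxBr mulmx1 -scalemxAl -scalemxAr WW !scalerA.
  by rewrite /c -mulrA divfK// mulr_natr mulr2n scalerDl opprB addrK subrK.
have t2 : x *m w^T = (enorm w ^+ 2 / 2)%:M.
  have yx : y *m x^T = x *m y^T.
    by apply/matrixP => i j; rewrite !ord1 !mxE; apply: eq_bigr => k _;
       rewrite !mxE mulrC.
  have : w *m w^T = 2 *: (x *m w^T).
    rewrite -wE linearB/= mulmxBl !mulmxBr !enorm_dot -xy yx scaler_nat mulr2n.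
    by rewrite opprB addrA.
  rewrite enorm_dot => E.
  rewrite mulrC -scale_scalar_mx E scalerA mulVf ?scale1r//.
rewrite /P mulmxBr mulmx1 -scalemxAr mulmxA t2 mul_scalar_mx scalerA.
by rewrite /c mulrA divfK// divff// scale1r -wE opprB addrC subrK.
Qed.

Variable n : nat.
Local Notation leb := (lebesgue_rV R n.+1).

(** In the coordinates hQ, these are the directions that lead from a point on or above the graph of
    an L-Lipschitz function to points strictly above it. *)
Definition cone (L : R) (Q : 'M[R]_n.+1) := [set h : 'rV[R]_n.+1 |
  L * enorm (col' ord_max (h *m Q)) < (h *m Q) ord0 ord_max].

Lemma continuous_cone_gap L (Q : 'M[R]_n.+1) : continuous (fun h : 'rV[R]_n.+1 =>
  (h *m Q) ord0 ord_max - L * enorm (col' ord_max (h *m Q))).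
Proof.
have ci i : continuous (fun h : 'rV[R]_n.+1 => (h *m Q) ord0 i).
  move=> x; apply: (@continuous_comp _ _ _ (fun h : 'rV[R]_n.+1 => h *m Q)
    (fun y : 'rV[R]_n.+1 => y ord0 i)); first exact: mulmx_rV_continuous.
  exact: coord_continuous.
have cc : continuous (fun h : 'rV[R]_n.+1 => enorm (col' ord_max (h *m Q))).
  move=> x; apply: (@continuous_comp _ _ _
    (fun h : 'rV[R]_n.+1 => col' ord_max (h *m Q)) (@enorm R n)).
    apply: continuous_rVP => i.
    rewrite (_ : (fun x => _) = (fun h => (h *m Q) ord0 (lift ord_max i))).
      exact: ci.
    by apply/funext => y; rewrite mxE.
  exact: enorm_continuous.
move=> x.
have cL : {for x, continuous (fun h : 'rV[R]_n.+1 => L * enorm (col' ord_max (h *m Q)))}.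
  apply: (@continuousM R 'rV[R]_n.+1 (cst L)
    (fun h => enorm (col' ord_max (h *m Q)))); last exact: cc.
  exact: cst_continuous.
exact: (continuousB (ci ord_max x) cL).
Qed.

Lemma open_cone L Q : open (cone L Q).
Proof.
rewrite (_ : cone L Q = (fun h : 'rV[R]_n.+1 =>
    (h *m Q) ord0 ord_max - L * enorm (col' ord_max (h *m Q))) @^-1` [set t | 0 < t]).
  by apply: open_comp; [move=> x _; exact: continuous_cone_gap|exact: open_gt].
by apply/seteqP; split => h; rewrite /cone/= subr_gt0.
Qed.

Lemma coneZ L Q (t : R) h : 0 < t -> cone L Q (t *: h) -> cone L Q h.
Proof.
move=> t0; rewrite /cone/= -scalemxAl linearZ/= enormZ mxE gtr0_norm//.
by rewrite mulrCA ltr_pM2l.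
Qed.

Variable nu : 'rV[R]_n.+1 -> R.
Hypotheses (mnu : measurable_fun setT nu) (nu0 : forall h, 0 <= nu h)
  (nu_radial : forall h k, enorm h = enorm k -> nu h = nu k).

Let mball r : measurable [set h : 'rV[R]_n.+1 | enorm h < r].
Proof. by apply: open_measurable_rV; exact: open_enorm_lt. Qed.

Let mcone r L Q : measurable ([set h | enorm h < r] `&` cone L Q).
Proof. by apply: measurableI => //; apply: open_measurable_rV; exact: open_cone. Qed.

(** The substitution h -> hP preserves Lebesgue measure, the ball and the radial [nu], and it pulls
    the cone of Q back to that of PQ. *)
Let cone_rot r L Q P : P *m P^T = 1%:M ->
  (\int[leb]_(h in [set h | (enorm h < r)%R] `&` cone L (P *m Q)) (nu h)%:E =
   \int[leb]_(h in [set h | (enorm h < r)%R] `&` cone L Q) (nu h)%:E)%E.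
Proof.
move=> PP; apply/esym.
rewrite (ge0_integral_preserving (orthogonal_preserving PP))//; last 2 first.
- by apply/measurable_EFinP; exact: measurable_funTS.
- by move=> h _; rewrite lee_fin.
rewrite (_ : _ @^-1` _ = [set h | enorm h < r] `&` cone L (P *m Q)).
  by apply: eq_integral => h _; congr _%:E; apply: nu_radial; rewrite enorm_mulmx.
by apply/seteqP; split => h [] /=; rewrite /cone/= enorm_mulmx// mulmxA.
Qed.

(** Each unit vector lies in some rotated copy of the cone, and by compactness of the sphere
    finitely many copies cover every direction. All copies carry the same mass, so that mass cannot
    be finite. *)
Lemma cone_integral (r L : R) (Q : 'M[R]_n.+1) : Q *m Q^T = 1%:M ->
  (\int[leb]_(h in [set h | (enorm h < r)%R]) (nu h)%:E = +oo)%E ->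
  nu 0 = 0 ->
  (\int[leb]_(h in [set h | (enorm h < r)%R] `&` cone L Q) (nu h)%:E = +oo)%E.
Proof.
(* The vector [e] is the unit vector on the axis of the cone. *)
move=> QQ nuoo nu00; pose e : 'rV[R]_n.+1 := delta_mx ord0 ord_max *m Q^T.
have QTQ : Q^T *m Q = 1%:M by exact: mulmx1C.
have eQ : e *m Q = delta_mx ord0 ord_max by rewrite -mulmxA QTQ mulmx1.
have e1 : enorm e = 1.
  rewrite enorm_mulmx ?trmxK// /enorm (bigD1 ord_max)//= big1 ?addr0.
    by rewrite mxE !eqxx expr1n sqrtr1.
  by move=> i imax; rewrite mxE eqxx (negbTE imax) expr0n.
have coneQe : cone L Q e.
  rewrite /cone/= eQ [X in enorm X](_ : _ = 0).
    by rewrite enorm0 mulr0 mxE !eqxx ltr01.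
  apply/rowP => i; rewrite !mxE eqxx/=.
  by rewrite eq_sym eq_liftF.
have /choice[P PP] (x : 'rV[R]_n.+1) : exists P : 'M[R]_n.+1,
    P *m P^T = 1%:M /\ (enorm x = 1 -> cone L (P *m Q) x).
  have [x1|x1] := eqVneq (enorm x) 1; last first.
    by exists 1%:M; split; [rewrite trmx1 mulmx1|move/eqP: x1].
  have [P PP xP] := orthogonal_transitive (etrans x1 (esym e1)).
  by exists P; split => // _; rewrite /cone/= mulmxA xP.
pose S := [set x : 'rV[R]_n.+1 | enorm x = 1].
have cS : compact S.
  apply: bounded_closed_compact.
    exists 1; split => // t t1 x /= x1; rewrite (le_trans _ (ltW t1))//.
    by rewrite -x1 mxnorm_le_enorm.
  apply: (@closed_comp _ _ (@enorm R n.+1) [set y | y = 1]); last exact: closed_eq.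
  by move=> x _; exact: enorm_continuous.
have [D _ cov] : finite_subset_cover S (fun x => cone L (P x *m Q)) S.
  move: cS; rewrite compact_cover; apply.
    by move=> x _; exact: open_cone.
  by move=> x Sx; exists x => //; exact: (PP x).2.
pose I := (\int[leb]_(h in [set h | (enorm h < r)%R] `&` cone L Q) (nu h)%:E)%E.
have : (+oo <= \sum_(x <- finmap.enum_fset D) I)%E.
  rewrite -nuoo (eq_bigr (fun x => \int[leb]_h
     (((EFin \o nu) \_ ([set h | (enorm h < r)%R] `&` cone L (P x *m Q))) h)))%E; last first.
    by move=> x _; rewrite -integral_mkcond cone_rot//; exact: (PP x).1.
  rewrite -ge0_integral_sum//; last 2 first.
  - move=> x; apply/(measurable_restrictT _ (mcone _ _ _)).
    by apply: measurable_funTS; exact/measurable_EFinP.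
  - by move=> x h _; apply: erestrict_ge0 => k _; rewrite lee_fin.
  rewrite [leLHS]integral_mkcond; apply: ge0_le_integral => //.
  - by move=> h _; apply: erestrict_ge0 => k _; rewrite lee_fin.
  - apply/(measurable_restrictT _ (mball _)).
    by apply: measurable_funTS; exact/measurable_EFinP.
  - apply: emeasurable_sum => x; apply/(measurable_restrictT _ (mcone _ _ _)).
    by apply: measurable_funTS; exact/measurable_EFinP.
  move=> h _.
  have pos x : (0 <= ((EFin \o nu) \_ ([set h | (enorm h < r)%R] `&` cone L (P x *m Q))) h)%E.
    by apply: erestrict_ge0 => k _; rewrite lee_fin.
  rewrite [leLHS]patchE; case: ifPn => [/set_mem hr|_]; last by apply: sume_ge0 => x _.
  (* The origin lies in no cone; there the pointwise bound rests on [nu 0 = 0]. *)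
  have [h0|h0] := eqVneq h 0.
    by rewrite {1}h0 nu00; apply: sume_ge0 => x _.
  have eh0 : 0 < enorm h by rewrite lt_neqAle enorm_ge0 eq_sym enorm_eq0 h0.
  have [x xD Cx] : exists2 x, x \in finmap.enum_fset D &
      cone L (P x *m Q) ((enorm h)^-1 *: h).
    by apply: cov; rewrite /S/= enormZ gtr0_norm ?invr_gt0// mulVf// gt_eqF.
  rewrite (big_rem _ xD)/= patchE ifT.
    by rewrite leeDl// sume_ge0.
  by apply: mem_set; split => //; apply: coneZ Cx; rewrite invr_gt0.
rewrite -/I leye_eq => /eqP.
have : (0 <= I)%E by apply: integral_ge0 => h _; rewrite lee_fin.
case: I => [s|//|//] s0.
by rewrite sumEFin.
Qed.

End cone.

                                           

(** * Simple kernels with uniformly large mass *)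

Lemma bounded_closure (R : realType) n (D : set 'rV[R]_n) :
  bounded_set D -> bounded_set (closure D).
Proof.
move=> [M [Mreal DM]]; exists M; split => // t Mt x Dx.
have ct : closed [set y : 'rV[R]_n | `|y| <= t].
  apply: (@closed_comp _ _ (fun y : 'rV[R]_n => `|y|) [set s | s <= t]).
    by move=> y _; exact: norm_continuous.
  exact: closed_le.
by apply: ct; move: Dx; apply: closure_subset => y; exact: DM.
Qed.

Section kernel_bound.
Import HBNNSimple.
Context {R : realType} {n : nat}.
Local Notation leb := (lebesgue_rV R n).
Variable nu : 'rV[R]_n -> R.
Hypotheses (mnu : measurable_fun setT nu) (nu0 : forall h, 0 <= nu h).
Variables (D E : set 'rV[R]_n).
Hypotheses (bD : bounded_set D) (oE : open E).
Hypothesis infinite : forall a, closure D a ->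
  (\int[leb]_(h in [set h | E (a + h)%R]) (nu h)%:E = +oo)%E.

Let mnuE : measurable_fun setT (EFin \o nu).
Proof. exact/measurable_EFinP. Qed.

Let nu_ k := nnsfun_approx measurableT mnuE k.

Let nu_nd h : {homo (fun k => nu_ k h) : i j / (i <= j)%N >-> i <= j}.
Proof. by move=> i j ij; exact/lefP/nd_nnsfun_approx. Qed.

Let nu_cvg h : (nu_ k h)%:E @[k --> \oo] --> (nu h)%:E.
Proof. by apply: cvg_nnsfun_approx => // x _; rewrite lee_fin. Qed.

Let nu_le k h : nu_ k h <= nu h.
Proof.
rewrite -lee_fin -(cvg_lim _ (@nu_cvg h))//.
apply: lime_ge; first by apply/cvg_ex; eexists; exact: (@nu_cvg h).
near=> j; rewrite lee_fin; apply: nu_nd.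
by near: j; exists k.
Unshelve. all: by end_near. Qed.

                                                                                
                                                 
(** The safety margin makes the condition stable: if x is within 1/(k+1) of a, then x + h is still
    in E. As k grows these sets exhaust E - a, because E is open. *)
Let G a k := [set h : 'rV[R]_n | ball (a + h) k.+1%:R^-1 `<=` E].

Let mG a k : measurable (G a k).
Proof.
rewrite -(setCK (G a k)); apply: measurableC; apply: open_measurable_rV.
(* The complement is a union of open balls, so [G a k] is closed. *)
rewrite (_ : ~` G a k = \bigcup_(z in ~` E) ball (z - a) k.+1%:R^-1).
  by apply: bigcup_open => z _; exact: ball_open.
apply/seteqP; split=> h /=.
  move=> /existsNP[z /not_implyP[hz Ez]]; exists z => //.
  move: hz; rewrite -!ball_normE/= (_ : z - a - h = - (a + h - z)) ?normrN//.
  by rewrite opprB opprD addrA.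
move=> [z Ez hz] Gz; apply/Ez/Gz.
move: hz; rewrite -!ball_normE/= (_ : z - a - h = - (a + h - z)) ?normrN//.
by rewrite opprB opprD addrA.
Qed.

Let G_nd a : {homo G a : i j / (i <= j)%N >-> i `<=` j}.
Proof.
move=> i j ij h; apply: subset_trans; apply: le_ball.
by rewrite lef_pV2 ?posrE// ler_nat.
Qed.

Let G_cvg a h : E (a + h) -> exists k, G a k h.
Proof.
move=> Eah; have /nbhs_ballP[e /= e0 eE] := open_nbhs_nbhs (conj oE Eah).
have [k ke] : exists k, k.+1%:R^-1 <= e.
  have := near_infty_natSinv_lt (PosNum e0) => -[k _ /(_ k (leqnn k)) ke].
  by exists k; exact: ltW.
by exists k; apply: subset_trans eE; exact: le_ball.
Qed.

(** Monotone convergence: the functions [nu_ k], cut off to [G a k], increase to [nu] on E - a,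
    whose integral is infinite. *)
Let G_int a (N : R) : closure D a ->
  exists k, (N%:E <= \int[leb]_(h in G a k) (nu_ k h)%:E)%E.
Proof.
move=> Da.
pose g k h := ((EFin \o nu_ k) \_ (G a k)) h.
have g0 k h : (0 <= g k h)%E.
  by apply: erestrict_ge0 => x _; rewrite lee_fin.
have mg k : measurable_fun setT (g k).
  apply/(measurable_restrictT _ (mG a k)).
  by apply: measurable_funTS; exact/measurable_EFinP.
have gnd h : {homo g^~ h : i j / (i <= j)%N >-> (i <= j)%E}.
  move=> i j ij; rewrite /g !patchE; case: ifPn => [|_]; last exact: g0.
  rewrite inE => Gi; rewrite ifT ?lee_fin; first exact: nu_nd.
  by rewrite inE; exact: G_nd ij _ Gi.
have glim h : limn (g^~ h) = ((EFin \o nu) \_ [set h | E (a + h)]) h.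
  apply/cvg_lim => //; rewrite patchE; case: ifPn => [|]; rewrite ?inE ?notin_setE/=.
    move=> /G_cvg[k0 Gk0]; apply: cvg_trans (@nu_cvg h).
    apply: near_eq_cvg; exists k0 => // k /= k0k; rewrite /g patchE ifT//.
    by rewrite inE; exact: G_nd k0k _ Gk0.
  move=> Eah; rewrite (_ : g^~ h = cst 0%E); first exact: cvg_cst.
  apply/funext => k; rewrite /g patchE ifF//; apply/negbTE; rewrite notin_setE => Gk.
  by apply: Eah; apply: Gk; exact: ballxx.
have : (\int[leb]_h g k h @[k --> \oo] --> \int[leb]_h limn (g^~ h))%E.
  by apply: cvg_monotone_convergence => // x _; exact: gnd.
rewrite (_ : (\int[leb]_h limn (g^~ h) = +oo)%E); last first.
  by under eq_integral do rewrite glim; rewrite -integral_mkcond infinite.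
move=> /cvgeyPge/(_ N)[k _ /(_ k (leqnn k))] /=.
by rewrite -integral_mkcond; exists k.
Qed.

(** The kernel is nu_k(y - x) for one simple approximation nu_k of [nu]. By [G_int] some index works
    at a; the margin in [G] extends it to a ball around a, monotonicity to all larger indices, and
    compactness of the closure of D makes one index serve everywhere. *)
Lemma kernel_bound (N : R) : exists K : 'rV[R]_n * 'rV[R]_n -> R,
  [/\ measurable_fun setT K, finite_set (range K),
      forall z, 0 <= K z <= nu (z.2 - z.1) &
      forall x, D x -> (N%:E <= \int[leb]_(y in E) (K (x, y))%:E)%E].
Proof.
have mE : measurable E by exact: open_measurable_rV.
have cD : compact (closure D).
  apply: bounded_closed_compact; last exact: closed_closure.
  exact: bounded_closure.
have mshift x : measurable_fun setT (fun h : 'rV[R]_n => x + h).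
  exact: measurable_rV_fun_add.
have mEx x : measurable [set h | E (x + h)].
  by rewrite -[X in measurable X]setTI; exact: (mshift x measurableT _ mE).
have [k _ kN] : \forall k \near \oo, closure D `<=`
    [set x | (N%:E <= \int[leb]_(h in [set h | E (x + h)%R]) (nu_ k h)%:E)%E].
  move/compact_near_coveringP : cD; apply => a /(G_int N)[k0 Nk0].
  exists (ball a k0.+1%:R^-1, [set k | (k0 <= k)%N]).
    split => /=; [exact: nbhsx_ballx|by exists k0].
  move=> [x k] /= [ax k0k]; apply: (le_trans Nk0).
  apply: (@le_trans _ _ (\int[leb]_(h in [set h | E (x + h)%R]) (nu_ k0 h)%:E)%E).
    apply: ge0_subset_integral => //.
    - by apply: measurable_funTS; exact/measurable_EFinP.
    - by move=> h _; rewrite lee_fin.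
    move=> h; apply.
    by move: ax; rewrite -!ball_normE/= [x + h]addrC opprD addrA addrK.
  apply: ge0_le_integral => //.
  - by move=> h _; rewrite lee_fin.
  - by apply: measurable_funTS; exact/measurable_EFinP.
  - by apply: measurable_funTS; exact/measurable_EFinP.
  - by move=> h _; rewrite lee_fin; exact: nu_nd.
exists (fun z => nu_ k (z.2 - z.1)).
have msub : measurable_fun setT (fun z : 'rV[R]_n * 'rV[R]_n => z.2 - z.1).
  apply: measurable_rV_fun_add; first exact: measurable_snd.
  exact: (measurableT_comp (@measurable_rV_opp R n)).
split.
- exact: measurableT_comp.
- apply: (@sub_finite_set _ _ (range (nu_ k))); last exact: fimfunP.
  by move=> _ [z _ <-]; exists (z.2 - z.1).
- by move=> z; rewrite nu_le fun_ge0.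
move=> x Dx /=.
rewrite (ge0_integral_preserving (lebesgue_rV_translation x))//; last 2 first.
- apply/measurable_EFinP; apply: measurable_funTS.
  apply: measurableT_comp => //; apply: measurable_rV_add.
- by move=> y _; rewrite lee_fin.
have := kN k (leqnn k) x (subset_closure Dx).
under [X in _ -> (_ <= X)%E]eq_integral do rewrite addrK.
rewrite (_ : _ @^-1` _ = [set h | E (x + h)])//.
by apply/seteqP; split => h /=; rewrite addrC.
Qed.

End kernel_bound.

(** Read off the supremum over simple functions that defines the integral, so that it applies
    directly to sets such as [inner_set]. *)
Lemma ge0_le_integral_subset d (T : measurableType d) (R : realType)
    (mu : {measure set T -> \bar R}) (A B : set T) (f : T -> \bar R) :
  (forall x, B x -> 0 <= f x)%E -> A `<=` B ->
  (\int[mu]_(x in A) f x <= \int[mu]_(x in B) f x)%E.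
Proof.
move=> f0 AB; rewrite !ge0_integralE//; last by move=> x /AB; exact: f0.
apply: ereal_sup_le => _ [h /= hf <-]; exists h => //= x.
apply: (le_trans (hf x)); rewrite !patchE; case: ifPn => [|_].
  by rewrite inE => /AB xB; rewrite ifT// inE.
by case: ifPn => // /set_mem /f0.
Qed.

(** * Divergence of the integral of [nu] at points of the closure *)

Section levy_kernel.
Context {R : realType} {n : nat}.
Local Notation leb := (lebesgue_rV R n.+1).
Variable nu : 'rV[R]_n.+1 -> R.

                                                 
(** The value of [nu] at 0 is arbitrary; fixing it to 0 gives a kernel that is nonnegative, even and
    measurable on the whole space. *)
Definition nu_ext (h : 'rV[R]_n.+1) : R := if h == 0 then 0 else nu h.

Lemma nu_ext0 : nu_ext 0 = 0. Proof. by rewrite /nu_ext eqxx. Qed.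

Lemma nu_extE h : h != 0 -> nu_ext h = nu h.
Proof. by rewrite /nu_ext => /negbTE ->. Qed.

Variable Omega : set 'rV[R]_n.+1.
Hypothesis adm : admissible nu Omega.

Let oO : open Omega. Proof. by case: adm => [[]]. Qed.

Lemma nu_ext_ge0 h : 0 <= nu_ext h.
Proof.
case: adm => [[_ _ _ nu0] _]; rewrite /nu_ext; case: ifPn => //; exact: nu0.
Qed.

Lemma nu_ext_patch : nu_ext = nu \_ [set~ 0].
Proof.
apply/funext => h; rewrite patchE /nu_ext; case: ifPn => [/eqP->|h0].
  by rewrite ifF//; apply/negbTE; rewrite notin_setE => /(_ erefl).
by rewrite ifT// inE; exact/eqP.
Qed.

Let m0 : measurable [set~ (0 : 'rV[R]_n.+1)].
Proof.
apply: open_measurable_rV.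
rewrite (_ : [set~ _] = @enorm R n.+1 @^-1` [set t | 0 < t]).
  by apply: open_comp; [move=> x _; exact: enorm_continuous|exact: open_gt].
apply/seteqP; split => h /=.
  by move=> /eqP h0; rewrite lt_neqAle enorm_ge0 eq_sym enorm_eq0 h0.
by move=> h0 hh; move: h0; rewrite hh enorm0 ltxx.
Qed.

Lemma measurable_nu_ext : measurable_fun setT nu_ext.
Proof.
case: adm => [[_ _ mnu _] _].
by rewrite nu_ext_patch; apply/(measurable_restrictT _ m0).
Qed.

Lemma nu_extN h : nu_ext (- h) = nu_ext h.
Proof.
case: adm => [_ [nuN _ _]]; rewrite /nu_ext oppr_eq0; case: ifPn => // h0.
by rewrite -nuN.
Qed.

Let mlt r : measurable [set h : 'rV[R]_n.+1 | enorm h < r].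
Proof. by apply: open_measurable_rV; exact: open_enorm_lt. Qed.

(** Outside the ball min(1, |h|^2) is at least m = min(1, r^2), so the mass there is at most 1/m
    times the finite Levy integral; the infinite total mass must sit inside. *)
Lemma nu_ext_ball_infinite (r : R) : 0 < r ->
  (\int[leb]_(h in [set h | (enorm h < r)%R]) (nu_ext h)%:E = +oo)%E.
Proof.
move=> r0; have [_ [_ levy infinite]] := adm.
have mn := measurable_nu_ext.
pose m := Num.min 1 (r ^+ 2).
have m_gt0 : 0 < m by rewrite /m lt_min ltr01 exprn_gt0.
have mmin : measurable_fun setT (fun h : 'rV[R]_n.+1 => Num.min 1 (enorm h ^+ 2)).
  by apply: measurable_minr => //; exact: measurable_enorm_sqr.
have out : (\int[leb]_(h in ~` [set h | (enorm h < r)%R]) (nu_ext h)%:E < +oo)%E.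
  apply: (@le_lt_trans _ _ (m^-1%:E * \int[leb]_h
      (Num.min 1 (enorm h ^+ 2) * nu_ext h)%:E)%E).
    rewrite -ge0_integralZl//; last 3 first.
    - by apply/measurable_EFinP; apply: measurable_funM.
    - by move=> h _; rewrite lee_fin mulr_ge0 ?nu_ext_ge0// le_min ler01 sqr_ge0.
    - by rewrite lee_fin invr_ge0 ltW.
    apply: (@le_trans _ _ (\int[leb]_(h in ~` [set h | (enorm h < r)%R])
        (m^-1%:E * (Num.min 1 (enorm h ^+ 2) * nu_ext h)%:E))%E); last first.
      apply: ge0_le_integral_subset => // h _.
      by rewrite -EFinM lee_fin mulr_ge0 ?invr_ge0 ?(ltW m_gt0)// mulr_ge0 ?nu_ext_ge0//
        le_min ler01 sqr_ge0.
    apply: ge0_le_integral => //.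
    - exact: measurableC.
    - by move=> h _; rewrite lee_fin nu_ext_ge0.
    - by apply/measurable_EFinP; exact: measurable_funTS.
    - apply: measurable_funeM; apply/measurable_EFinP; apply: measurable_funTS.
      exact: measurable_funM.
    move=> h /= /negP; rewrite -leNgt => rh; rewrite -EFinM lee_fin mulrA.
    rewrite ler_peMl ?nu_ext_ge0// mulrC ler_pdivlMr// mul1r /m.
    rewrite le_min ge_min lexx/= ge_min; apply/orP; right.
    by rewrite ler_pXn2r// ?nnegrE ?enorm_ge0// ltW.
  rewrite lte_mul_pinfty ?lee_fin ?invr_ge0 ?(ltW m_gt0)//.
  rewrite (le_lt_trans _ levy)// [leRHS]integral_mkcond.
  rewrite le_eqVlt; apply/orP; left; apply/eqP; apply: eq_integral => h _.
  rewrite patchE nu_ext_patch patchE; case: ifPn => //.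
  by rewrite mulr0.
have tot : (\int[leb]_h (nu_ext h)%:E = +oo)%E.
  rewrite -infinite [RHS]integral_mkcond; apply: eq_integral => h _.
  by rewrite nu_ext_patch !patchE; case: ifPn.
move: tot; rewrite -(setvU [set h | enorm h < r]) setUC ge0_integral_setU//=.
- move=> tot; move: out.
  have : (0 <= \int[leb]_(h in ~` [set h | (enorm h < r)%R]) (nu_ext h)%:E)%E.
    by apply: integral_ge0 => h _; rewrite lee_fin nu_ext_ge0.
  move: tot; case: (integral _ (~` _) _) => // s tot _ _.
  by move: tot; case: (integral _ _ _).
- exact: measurableC.
- by apply/measurable_EFinP; exact: measurable_funTS.
- by move=> h _; rewrite lee_fin nu_ext_ge0.
- by rewrite disj_set2E setICr.
Qed.

Lemma interior_infinite (E : set 'rV[R]_n.+1) a : open E -> E a ->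
  (\int[leb]_(h in [set h | E (a + h)%R]) (nu_ext h)%:E = +oo)%E.
Proof.
move=> oE Ea.
have /nbhs_ballP[r /= r0 rE] := open_nbhs_nbhs (conj oE Ea).
apply/eqP; rewrite -leye_eq -(nu_ext_ball_infinite r0).
apply: ge0_le_integral_subset => [h _|h /= hr]; first by rewrite lee_fin nu_ext_ge0.
(* [rE] concerns a sup-norm ball; the Euclidean ball of the same radius lies inside it. *)
apply: rE; rewrite -ball_normE/= opprD addrA subrr add0r normrN.
exact: le_lt_trans (mxnorm_le_enorm _) hr.
Qed.

Let iO : Omega^° = Omega. Proof. by move: oO; rewrite interior_id. Qed.

Let boundaryP a : closure Omega a -> Omega a \/ boundary Omega a.
Proof.
move=> ca; have [Oa|Oa] := pselect (Omega a); first by left.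
by right; split => //; rewrite iO.
Qed.

(** At a boundary point the integral is at least [qtilde] at every positive delta, hence at least
    any N. *)
Lemma class_A3_infinite a : class_A3 nu Omega -> closure Omega a ->
  (\int[leb]_(h in [set h | Omega (a + h)%R]) (nu_ext h)%:E = +oo)%E.
Proof.
move=> [_ qoo] /boundaryP[|ba]; first exact: interior_infinite.
have mO : measurable Omega by exact: open_measurable_rV.
have Oa : ~ Omega a by case: ba => _; rewrite iO.
have -> : (\int[leb]_(h in [set h | Omega (a + h)%R]) (nu_ext h)%:E =
    \int[leb]_(h in Omega) (nu_ext (h - a))%:E)%E.
  rewrite [RHS](ge0_integral_preserving (lebesgue_rV_translation a))//; last 2 first.
  - apply/measurable_EFinP; apply: measurable_funTS.
    by apply: measurableT_comp; [exact: measurable_nu_ext|exact: measurable_rV_add].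
  - by move=> h _; rewrite lee_fin nu_ext_ge0.
  under [RHS]eq_integral do rewrite addrK.
  rewrite (_ : [set h | Omega (a + h)] = (fun h => h + a) @^-1` Omega)//.
  by apply/seteqP; split => h /=; rewrite addrC.
apply/eqyP => N N0.
move/cvgeyPge : qoo => /(_ N) qN.
have [d /le_trans] := @filter_ex R (0:R)^'+ _ _ qN; apply.
apply: (@le_trans _ _ (\int[leb]_(h in inner_set Omega d) (nu (h - a)%R)%:E)%E).
  by apply: ereal_inf_lbound; exists a.
rewrite (eq_integral (fun h : 'rV[R]_n.+1 => (nu_ext (h - a))%:E)); last first.
  move=> h; rewrite inE => -[Oh _]; rewrite nu_extE// subr_eq0.
  by apply/eqP => ha; rewrite ha in Oh.
apply: ge0_le_integral_subset => [h _|h []//].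
by rewrite lee_fin nu_ext_ge0.
Qed.

(** At a boundary point, in the rotated coordinates, a lies on or above the graph of g. Adding a
    short vector of the cone of slope |L| raises the last coordinate by more than g can grow, so
    Omega - a contains a truncated cone. *)
Lemma class_A2_infinite a : class_A2 nu Omega -> closure Omega a ->
  (\int[leb]_(h in [set h | Omega (a + h)%R]) (nu_ext h)%:E = +oo)%E.
Proof.
move=> [_ lip radial _] ca; have [|ba] := boundaryP ca; first exact: interior_infinite.
have [r [L [Q [g [r0 QQ gL OQ]]]]] := lip _ ba.
have gL' y z : g y <= g z + `|L| * enorm (y - z).
  rewrite -lerBlDl (le_trans (ler_norm _))// (le_trans (gL _ _))//.
  by rewrite ler_wpM2r ?enorm_ge0 ?ler_norm.
have ga : g (col' ord_max (a *m Q)) <= (a *m Q) ord0 ord_max.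
  (* If a were strictly below the graph, by [c], then so would be all x near a for which
     [gap (x - a)] is below [c], although a is a limit of points of Omega. *)
  rewrite leNgt; apply/negP => ag.
  pose gap h := (h *m Q) ord0 ord_max - (- `|L|) * enorm (col' ord_max (h *m Q)).
  pose c := g (col' ord_max (a *m Q)) - (a *m Q) ord0 ord_max.
  have oW : open ([set h : 'rV[R]_n.+1 | enorm h < r] `&` [set h | gap h < c]).
    apply: openI; first exact: open_enorm_lt.
    apply: (@open_comp _ _ gap [set t | t < c]); last exact: open_lt.
    by move=> x _; exact: continuous_cone_gap.
  have W0 : ([set h : 'rV[R]_n.+1 | enorm h < r] `&` [set h | gap h < c]) 0.
    split; first by rewrite /= enorm0.
    rewrite /gap/= mul0mx mxE [X in enorm X](_ : _ = 0) ?enorm0 ?mulr0 ?subr0 ?subr_gt0//.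
    by apply/rowP => i; rewrite !mxE.
  have /nbhs_ballP[e /= e0 eW] := open_nbhs_nbhs (conj oW W0).
  have [x [Ox ax]] := ca _ (nbhsx_ballx a e e0).
  have [/= xr xc] : ([set h : 'rV[R]_n.+1 | enorm h < r] `&` [set h | gap h < c]) (x - a).
    by apply: eW; move: ax; rewrite -!ball_normE/= sub0r normrN distrC.
  have gx := (OQ x xr).1 Ox.
  have := gL' (col' ord_max (a *m Q)) (col' ord_max (x *m Q)).
  rewrite (_ : _ - _ = - col' ord_max ((x - a) *m Q)); last first.
    by apply/rowP => i; rewrite mulmxBl !mxE opprB.
  rewrite enormN; move: xc; rewrite /gap /c mulNr opprK mulmxBl.
  rewrite (_ : (x *m Q - a *m Q) ord0 ord_max =
    (x *m Q) ord0 ord_max - (a *m Q) ord0 ord_max); last by rewrite !mxE.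
  by move: gx; set A := enorm _; lra.
have inf := nu_ext_ball_infinite r0.
have rad h k : enorm h = enorm k -> nu_ext h = nu_ext k.
  move=> hk; have [h0|h0] := eqVneq h 0.
    by have -> : k = h by apply/eqP; rewrite h0 -enorm_eq0 -hk h0 enorm0.
  have k0 : k != 0 by rewrite -enorm_eq0 -hk enorm_eq0.
  by rewrite !nu_extE//; exact: radial.
apply/eqP; rewrite -leye_eq.
rewrite -(cone_integral measurable_nu_ext nu_ext_ge0 rad `|L| QQ inf nu_ext0).
apply: ge0_le_integral_subset => [h _|h /= [hr hc]]; first by rewrite lee_fin nu_ext_ge0.
apply/OQ; first by rewrite addrC addKr.
apply: (le_lt_trans (gL' _ (col' ord_max (a *m Q)))).
rewrite (_ : _ - _ = col' ord_max (h *m Q)); last first.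
  by apply/rowP => i; rewrite mulmxDl !mxE addrC addKr.
rewrite mulmxDl [ltRHS]mxE; apply: ler_ltD => //.
Qed.

End levy_kernel.

                       

(** * The spaces of the theorem and the embeddings *)

Section L2_norm.
Context {R : realType} {n : nat}.
Local Notation leb := (lebesgue_rV R n).
Implicit Types (D : set 'rV[R]_n) (u : 'rV[R]_n -> R).

Let sqr_patch D u : (\int[leb]_x ((u \_ D) x ^+ 2)%:E =
  \int[leb]_(x in D) (u x ^+ 2)%:E)%E.
Proof.
rewrite [RHS]integral_mkcond; apply: eq_integral => x _.
by rewrite !patchE; case: ifPn => //; rewrite expr0n.
Qed.

Let Lnorm_sqr D u : (\int[leb]_x `|((u \_ D) x)%:E| `^ 2 =
  \int[leb]_(x in D) (u x ^+ 2)%:E)%E.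
Proof.
rewrite -sqr_patch; apply: eq_integral => x _.
by rewrite abse_EFin poweR_EFin powR_mulrn// real_normK ?num_real.
Qed.

Lemma L2norm_sqrt D u :
  L2norm D u = ((\int[leb]_(x in D) (u x ^+ 2)%:E) `^ 2^-1)%E.
Proof. by rewrite /L2norm unlock Lnorm_sqr. Qed.

Lemma L2norm_sqr D u : (L2norm D u ^+ 2 = \int[leb]_(x in D) (u x ^+ 2)%:E)%E.
Proof.
rewrite L2norm_sqrt; have : (0 <= \int[leb]_(x in D) (u x ^+ 2)%:E)%E.
  by apply: integral_ge0 => x _; rewrite lee_fin sqr_ge0.
case: (integral _ _ _) => [s| |]// s0.
  by rewrite poweR_EFin -EFin_expe powR12_sqrt// sqr_sqrtr.
by rewrite poweRyr ?invr_neq0// expe2 mulyy.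
Qed.

Lemma L2P D u : measurable D -> L2 D u <->
  measurable_fun D u /\ (\int[leb]_(x in D) (u x ^+ 2)%:E < +oo)%E.
Proof.
move=> mD; rewrite /L2/=; split.
  move=> /andP[/set_mem mu /set_mem fu]; split; first exact/(measurable_restrictT _ mD).
  have : (L2norm D u < +oo)%E by [].
  by rewrite L2norm_sqrt => /lty_poweRy; apply; rewrite invr_neq0.
move=> [mu fu]; apply/andP; split; apply/mem_set.
  by apply/(measurable_restrictT _ mD).
have : (L2norm D u < +oo)%E by rewrite L2norm_sqrt; exact: poweR_lty.
by [].
Qed.

End L2_norm.

Section compact_embedding.
Context {R : realType} {n : nat}.
Local Notation leb := (lebesgue_rV R n.+1).
Variables (nu : 'rV[R]_n.+1 -> R) (Omega : set 'rV[R]_n.+1).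
Hypothesis adm : admissible nu Omega.
Implicit Types (D E : set 'rV[R]_n.+1) (u v : 'rV[R]_n.+1 -> R).

Let oO : open Omega. Proof. by case: adm => [[]]. Qed.
Let bO : bounded_set Omega. Proof. by case: adm => [[]]. Qed.
Let mO : measurable Omega. Proof. exact: open_measurable_rV. Qed.

Let k (z : 'rV[R]_n.+1 * 'rV[R]_n.+1) := nu_ext nu (z.2 - z.1).

Let k0 z : 0 <= k z. Proof. exact: nu_ext_ge0 adm _. Qed.

Let mk : measurable_fun setT k.
Proof.
apply: measurableT_comp; first exact: measurable_nu_ext adm.
apply: measurable_rV_fun_add; first exact: measurable_snd.
exact: (measurableT_comp (@measurable_rV_opp R n.+1)).
Qed.

(** On the diagonal the square vanishes; off it [nu] is even. *)
Let energy_integrand u (x y : 'rV[R]_n.+1) :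
  (u x - u y) ^+ 2 * nu (x - y) = (u x - u y) ^+ 2 * k (x, y).
Proof.
have [->|xy] := eqVneq x y; first by rewrite subrr expr0n !mul0r.
congr (_ * _); rewrite /k/= -(nu_extN adm) opprB nu_extE//.
by rewrite subr_eq0.
Qed.

Lemma energyE D u : energy nu D u = (\int[(leb \x leb)%E]_(z in D `*` D)
  ((u z.1 - u z.2) ^+ 2 * k z)%:E)%E.
Proof. by apply: eq_integral => -[x y] _ /=; rewrite energy_integrand. Qed.

Lemma energy_ge0 D u : (0 <= energy nu D u)%E.
Proof.
by rewrite energyE; apply: integral_ge0 => z _; rewrite lee_fin mulr_ge0// sqr_ge0.
Qed.

(** After Tonelli, the inner integral only gains by running over the whole space instead of
    Omega. *)
Lemma energy_le_Venergy u : measurable_fun setT u ->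
  (energy nu Omega u <= Venergy nu Omega u)%E.
Proof.
move=> mu; rewrite energyE /Venergy.
have me : measurable_fun setT (fun z : 'rV[R]_n.+1 * 'rV[R]_n.+1 =>
    ((u z.1 - u z.2) ^+ 2 * k z)%:E).
  apply/measurable_EFinP; apply: measurable_funM => //; apply: measurable_funX.
  by apply: measurable_funB; exact: measurableT_comp.
have e0 z : (0 <= ((u z.1 - u z.2) ^+ 2 * k z)%:E)%E.
  by rewrite lee_fin mulr_ge0// sqr_ge0.
rewrite tonelli_setX//.
under [leRHS]eq_integral => x _ do under eq_integral do rewrite energy_integrand.
apply: ge0_le_integral => //.
- by move=> x _; apply: integral_ge0 => y _; exact: e0.
- by apply: measurable_funTS; exact: measurable_integral_setX me e0.
- by apply: measurable_funTS; exact: measurable_integral_setX me e0.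
by move=> x _; apply: ge0_le_integral_subset => // y _; exact: e0.
Qed.

Lemma bounded_lebesgue_lty E : bounded_set E -> measurable E -> (leb E < +oo)%E.
Proof.
move=> [M [_ EM]] mE; pose c := `|M| + 1.
apply: (@le_lt_trans _ _
    (leb [set x : 'rV[R]_n.+1 | forall i, `[- c, c]%classic (x ord0 i)])).
  apply: le_measure; rewrite ?inE//.
    rewrite (_ : mkset _ = \bigcap_(i in [set: 'I_n.+1]) (rV_coord i @^-1` `[- c, c]%classic)).
      apply: fin_bigcap_measurable => // i _.
      by rewrite -[X in measurable X]setTI; exact: measurable_rV_coord.
    by apply/seteqP; split => x /= h i; [move=> _|]; exact: h.
  move=> x Ex i; rewrite /= in_itv/= -ler_norml.
  have : `|x| <= c by apply: EM => //; rewrite /c ltr_pwDr// ler_norm.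
  apply: le_trans; change (`|x ord0 i| <= mx_norm x).
  by rewrite mx_normrE; apply: (le_bigmax _ (fun ij => `|x ij.1 ij.2|) (ord0, i)).
rewrite (lebesgue_rV_prod (A := fun=> `[- c, c]%classic)); last first.
  by move=> i; exact: measurable_itv.
rewrite (eq_bigr (fun=> (c - - c)%:E)); last first.
  by move=> i _; rewrite lebesgue_measure_itv/= lte_fin ifT// gtrN// /c ltr_wpDl.
by rewrite prodEFin ltry.
Qed.

(** The abstract criterion for the kernel nu(y - x), applied to the functions set to 0 outside E.
    Two sets are kept apart because class A1 takes for E a ball larger than D = Omega. *)
Lemma subsequence_cvg D E (v : nat -> 'rV[R]_n.+1 -> R) (A : R) :
  measurable D -> D `<=` E -> open E -> bounded_set E ->
  (forall a, closure D a ->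
    (\int[leb]_(h in [set h | E (a + h)%R]) (nu_ext nu h)%:E = +oo)%E) ->
  (forall i, measurable_fun E (v i)) ->
  (forall i, \int[leb]_(x in E) (v i x ^+ 2)%:E <= A%:E)%E ->
  (forall i, energy nu E (v i) <= A%:E)%E ->
  exists phi : nat -> nat, {homo phi : i j / (i < j)%N} /\
  exists2 w : 'rV[R]_n.+1 -> R, measurable_fun setT w &
    (\int[leb]_(x in D) ((v (phi i) x - w x) ^+ 2)%:E @[i --> \oo] --> 0)%E.
Proof.
move=> mD DE oE bE infinite mv vA eA.
have mE : measurable E by exact: open_measurable_rV.
have bD : bounded_set D.
  by case: bE => M [Mreal EM]; exists M; split => // t Mt x /DE; exact: EM.
pose f i := v i \_ E.
have fE i x : ~ E x -> f i x = 0.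
  by move=> Ex; rewrite /f patchE ifF//; apply/negbTE; rewrite notin_setE.
have fA i : (\int[leb]_x (f i x ^+ 2)%:E <= A%:E)%E.
  apply: le_trans (vA i); rewrite [leRHS]integral_mkcond.
  rewrite le_eqVlt; apply/orP; left; apply/eqP; apply: eq_integral => x _.
  by rewrite /f !patchE; case: ifPn => //; rewrite expr0n.
have fkA i : (\int[(leb \x leb)%E]_(z in E `*` E)
    ((f i z.1 - f i z.2) ^+ 2 * k z)%:E <= A%:E)%E.
  apply: le_trans (eA i); rewrite energyE.
  rewrite le_eqVlt; apply/orP; left; apply/eqP; apply: eq_integral => -[x y].
  by rewrite in_setX/= => /andP[xE yE]; rewrite /f !patchE xE yE.
have [phi [phiS [w mw vw]]] := l2_subsequence mD mE DE (bounded_lebesgue_lty bE mE) mk k0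
  (kernel_bound (measurable_nu_ext adm) (nu_ext_ge0 adm) bD oE infinite)
  (fun i => (measurable_restrictT _ mE).1 (mv i)) fE fA fkA.
exists phi; split => //; exists w => //; apply: cvg_trans vw; apply: near_eq_cvg.
apply: nearW => i; apply: eq_integral => x /set_mem/DE xE.
by rewrite patchE ifT// inE.
Qed.

Lemma L2norm_cvg (u : nat -> 'rV[R]_n.+1 -> R) (w : 'rV[R]_n.+1 -> R) :
  (forall i, L2 Omega (u i)) -> measurable_fun setT w ->
  (\int[leb]_(x in Omega) ((u i x - w x) ^+ 2)%:E @[i --> \oo] --> 0)%E ->
  L2 Omega w /\ (L2norm Omega (u i - w)%R @[i --> \oo] --> 0)%E.
Proof.
move=> Lu mw /fine_cvgP[fin cvg].
have mOw : measurable_fun Omega w by exact: measurable_funTS.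
have fin0 (f : 'rV[R]_n.+1 -> R) : (0 <= \int[leb]_(x in Omega) (f x ^+ 2)%:E)%E.
  by apply: integral_ge0 => x _; rewrite lee_fin sqr_ge0.
split.
  apply/(L2P _ mO); split => //.
  have [i ifin] := filter_ex fin.
  have [mui uifin] := (L2P _ mO).1 (Lu i).
  have uifin' : (\int[leb]_(x in Omega) (u i x ^+ 2)%:E \is a fin_num)%E.
    by rewrite ge0_fin_numE.
  (* The limit is square integrable because w = u_i - (u_i - w), for an i at which the distance is
     finite. *)
  have : (\int[leb]_(x in Omega) ((u i x - (u i x - w x)) ^+ 2 * cst 1 x)%:E <=
      (2 * (fine (\int[leb]_(x in Omega) (u i x ^+ 2)%:E) +
       fine (\int[leb]_(x in Omega) ((u i x - w x) ^+ 2)%:E)))%:E)%E.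
    apply: ge0_integral_sqrB_le => //; first exact: measurable_funB.
      by under eq_integral do rewrite mulr1; rewrite fineK.
    by under eq_integral do rewrite mulr1; rewrite fineK.
  under eq_integral do rewrite mulr1 opprB addrC subrK.
  by move=> /le_lt_trans; apply; exact: ltry.
have LE i : L2norm Omega (u i - w) =
    ((\int[leb]_(x in Omega) ((u i x - w x) ^+ 2)%:E) `^ 2^-1)%E.
  by rewrite L2norm_sqrt.
under eq_fun do rewrite LE.
apply/fine_cvgP; split.
  by apply: filterS fin => i; exact: fin_num_poweR.
rewrite -[X in _ --> X]/(0 : R) -(@sqrtr0 R).
apply: cvg_trans (continuous_cvg _ (@sqrt_continuous R 0) cvg).
apply: near_eq_cvg; apply: nearW => i /=.
by rewrite fine_poweR powR12_sqrt// fine_ge0.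
Qed.

Lemma poweR_half_le (X : \bar R) (M : R) : (0 <= X)%E -> (X `^ 2^-1 <= M%:E)%E ->
  (X <= (M ^+ 2)%:E)%E.
Proof.
case: X => [s| |]// s0; last by rewrite poweRyr ?invr_neq0.
rewrite poweR_EFin powR12_sqrt// !lee_fin => sM.
by rewrite -(sqr_sqrtr s0) ler_pXn2r// nnegrE ?sqrtr_ge0// (le_trans _ sM)// sqrtr_ge0.
Qed.

Lemma Hnorm_le D u (M : R) : (Hnorm nu D u <= M%:E)%E ->
  (\int[leb]_(x in D) (u x ^+ 2)%:E <= (M ^+ 2)%:E)%E /\
  (energy nu D u <= (M ^+ 2)%:E)%E.
Proof.
have e0 := energy_ge0 D u.
have n0 : (0 <= \int[leb]_(x in D) (u x ^+ 2)%:E)%E.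
  by apply: integral_ge0 => x _; rewrite lee_fin sqr_ge0.
rewrite /Hnorm L2norm_sqr => /poweR_half_le; rewrite adde_ge0// => /(_ isT) h.
by split; apply: le_trans h; [exact: leeDl|exact: leeDr].
Qed.

Lemma H_embedding : (forall a, closure Omega a ->
    (\int[leb]_(h in [set h | Omega (a + h)%R]) (nu_ext nu h)%:E = +oo)%E) ->
  compact_operator (Hnu nu Omega) (Hnorm nu Omega) (L2 Omega) (L2norm Omega) id.
Proof.
move=> infinite; split=> [u []//|u Hu [M uM]].
have [phi [phiS [w mw uw]]] := subsequence_cvg mO (@subset_refl _ Omega) oO bO infinite
  (fun i => ((L2P _ mO).1 (Hu i).1).1)
  (fun i => (Hnorm_le (uM i)).1) (fun i => (Hnorm_le (uM i)).2).
exists phi; split => //.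
by have [] := L2norm_cvg (fun i => (Hu (phi i)).1) mw uw; exists w.
Qed.

(** The extensions are bounded in H_nu(R^d), hence on a ball containing the closure of Omega; every
    point of that closure is interior to the ball. They agree with the u_i almost everywhere on
    Omega, so the limit carries over. *)
Lemma H_embedding_extension : class_A1 nu Omega ->
  compact_operator (Hnu nu Omega) (Hnorm nu Omega) (L2 Omega) (L2norm Omega) id.
Proof.
move=> [_ [E [C [C0 EP _]]]]; split=> [u []//|u Hu [M uM]].
have [r Or] : exists r : R, closure Omega `<=` ball 0 r.
  have [M1 [_ OM1]] := bounded_closure bO; exists (`|M1| + 2) => x Ox.
  rewrite -ball_normE/= sub0r normrN.
  apply: (@le_lt_trans _ _ (`|M1| + 1)); last by rewrite ltrD2l ltr1n.
  by apply: OM1 => //; rewrite ltr_pwDr// ler_norm.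
have bB : bounded_set (ball (0 : 'rV[R]_n.+1) r).
  exists r; split; first exact: num_real.
  by move=> t rt x; rewrite -ball_normE/= sub0r normrN => /lt_trans/(_ rt)/ltW.
pose v i := E (u i).
have vM i : (Hnorm nu setT (v i) <= (C * M)%:E)%E.
  have [_ + _] := EP _ (Hu i); move=> /le_trans; apply.
  by rewrite EFinM lee_wpmul2l// lee_fin ltW.
have mv i : measurable_fun setT (v i).
  by have [[/(L2P _ measurableT)[]]] := EP _ (Hu i).
have [v2 ve] : (forall i, (\int[leb]_x (v i x ^+ 2)%:E <= ((C * M) ^+ 2)%:E)%E) /\
    forall i, (energy nu setT (v i) <= ((C * M) ^+ 2)%:E)%E.
  by split=> i; have [] := Hnorm_le (vM i).
have v2B i : (\int[leb]_(x in ball (0%R : 'rV[R]_n.+1) r) (v i x ^+ 2)%:E <=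
    ((C * M) ^+ 2)%:E)%E.
  apply: le_trans (v2 i); apply: ge0_le_integral_subset => // x _.
  by rewrite lee_fin sqr_ge0.
have veB i : (energy nu (ball (0%R : 'rV[R]_n.+1) r) (v i) <= ((C * M) ^+ 2)%:E)%E.
  apply: le_trans (ve i); rewrite !energyE; apply: ge0_le_integral_subset => // z _.
  by rewrite lee_fin mulr_ge0// sqr_ge0.
have [phi [phiS [w mw vw]]] := subsequence_cvg mO
  (subset_trans (@subset_closure _ Omega) Or) (ball_open _ _) bB
  (fun a ca => interior_infinite adm (ball_open _ _) (Or _ ca))
  (fun i => measurable_funTS (mv i)) v2B veB.
exists phi; split => //.
suff uw : (\int[leb]_(x in Omega) ((u (phi i) x - w x) ^+ 2)%:E @[i --> \oo] --> 0)%E.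
  by have [] := L2norm_cvg (fun i => (Hu (phi i)).1) mw uw; exists w.
apply: cvg_trans vw; apply: near_eq_cvg; apply: nearW => i.
have [_ _ uv] := EP _ (Hu (phi i)).
have mB2 (f : 'rV[R]_n.+1 -> R) : measurable_fun Omega f ->
    measurable_fun Omega (fun x => ((f x - w x) ^+ 2)%:E).
  move=> mf; apply/measurable_EFinP; apply: measurable_funX.
  by apply: measurable_funB => //; exact: measurable_funTS.
apply: ge0_ae_eq_integral => //.
- by apply: mB2; exact: measurable_funTS.
- by apply: mB2; exact: ((L2P _ mO).1 (Hu (phi i)).1).1.
- by move=> x _; rewrite lee_fin sqr_ge0.
- by move=> x _; rewrite lee_fin sqr_ge0.
by apply: filterS uv => x uvx Ox; rewrite /v uvx.
Qed.

(** A sequence bounded in the V-norm is bounded in the H-norm, and extending by 0 outside Omega does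
    not change the L^2(Omega) distance. *)
Lemma V_embedding :
  compact_operator (Hnu nu Omega) (Hnorm nu Omega) (L2 Omega) (L2norm Omega) id ->
  compact_operator (Vnu nu Omega) (Vnorm nu Omega) (L2 Omega) (L2norm Omega)
    (fun u => u \_ Omega).
Proof.
move=> [_ compactH].
have patch_id u v : (u \_ Omega - v) \_ Omega = (u - v) \_ Omega.
  apply/funext => x; rewrite !patchE; case: ifPn => // xO.
  by congr (_ - _); rewrite patchE xO.
split=> [u [_ Lu _]|u Vu [M uM]].
  by rewrite /L2/= -(subr0 (u \_ Omega)) patch_id subr0.
have HV i : (Hnu nu Omega (u i)).
  have [mu Lu Vu_fin] := Vu i; split => //.
  exact: le_lt_trans (energy_le_Venergy mu) Vu_fin.
have [|phi [phiS [v Lv uv]]] := compactH u HV.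
  exists M => i; apply: le_trans (uM i); rewrite /Hnorm /Vnorm.
  have [mu _ _] := Vu i.
  have e0 := energy_ge0 Omega (u i); have eV := energy_le_Venergy mu.
  have n0 : (0 <= L2norm Omega (u i) ^+ 2)%E by exact/expe_ge0/Lnorm_ge0.
  apply: gt0_ler_poweR => //.
  - by rewrite in_itv/= leey andbT adde_ge0.
  - by rewrite in_itv/= leey andbT adde_ge0// (le_trans e0).
  by rewrite leeD2l.
exists phi; split => //; exists v => //.
rewrite (_ : (fun i => _) = fun i => L2norm Omega (u (phi i) - v))//.
by apply/funext => i; rewrite /L2norm patch_id.
Qed.

End compact_embedding.

Theorem theorem3p10 (R : realType) (n : nat) (Omega : set 'rV[R]_n.+1)
    (nu : 'rV[R]_n.+1 -> R)
    (openOmega : open Omega) (bndOmega : bounded_set Omega)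
    (mnu : measurable_fun [set~ (0%R : 'rV[R]_n.+1)] nu)
    (nu_ge0 : forall h : 'rV[R]_n.+1, h != 0 -> 0 <= nu h)
    (classA : class_A1 nu Omega \/ class_A2 nu Omega \/ class_A3 nu Omega) :
  compact_operator (Hnu nu Omega) (Hnorm nu Omega)
                   (L2 Omega) (L2norm Omega) id /\
  compact_operator (Vnu nu Omega) (Vnorm nu Omega)
                   (L2 Omega) (L2norm Omega) (fun u => u \_ Omega).
Proof.
have adm : admissible nu Omega.
  by case: classA => [[]|[[]|[]]].
suff H : compact_operator (Hnu nu Omega) (Hnorm nu Omega)
    (L2 Omega) (L2norm Omega) id by split => //; exact: V_embedding.
case: classA => [A1|[A2|A3]].
- exact: H_embedding_extension.
- by apply: H_embedding => // a; exact: class_A2_infinite.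
- by apply: H_embedding => // a; exact: class_A3_infinite.
Qed.
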